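(* If $G$ is a finite simple graph that is even-hole free, then $\mathrm{reg}(G)\leq 3$.
   Context: All graphs are finite and simple. A hole is an induced (chordless) cycle of length at least four; a graph is even-hole free if it contains no hole of even length. Fix a field $k$ of characteristic $0$. For a graph $G$ with vertex set $[n]$, the non-edge ideal is $I(G)=\langle x_ix_j : i\neq j,\ ij\notin E(G)\rangle\subseteq k[x_1,\dots,x_n]$, and $\mathrm{reg}(G):=\max\{r : \beta_{i,i+r}(I(G))\neq 0 \text{ for some } i\}$ is its Castelnuovo-Mumford regularity, where $\beta_{i,j}$ are the graded Betti numbers. If $G$ is complete (so $I(G)=0$), $\mathrm{reg}(G)=1$ by convention. *)

(* Defs.v *)
From Stdlib Require Import ClassicalEpsilon.
From mathcomp Require Import all_boot all_order all_algebra.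
From mathcomp Require Import mpoly.

Set Implicit Arguments.
Unset Strict Implicit.
Unset Printing Implicit Defensive.

Import GRing.Theory.
Local Open Scope ring_scope.

(** A finite simple graph on n vertices is a symmetric irreflexive
    [e : rel 'I_n]. *)

Section Graphs.
Variables (n : nat) (e : rel 'I_n).

Definition complete_graph : Prop := forall i j : 'I_n, i != j -> e i j.

(* [c] lists the vertices of the cycle in cyclic order; the last clause says
   that the only edges among them are those of the cycle. *)
Definition is_hole (c : seq 'I_n) : Prop :=
  [/\ (4 <= size c)%N, ucycle e c
    & {in c &, forall x y, e x y -> (y == next c x) || (x == next c y)}].

Definition even_hole_free : Prop :=
  forall c : seq 'I_n, is_hole c -> odd (size c).

End Graphs.

Definition nonedge_ideal (k : fieldType) (n : nat) (e : rel 'I_n)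
    (p : {mpoly k[n]}) : Prop :=
  exists c : 'I_n -> 'I_n -> {mpoly k[n]},
    p = \sum_(i < n) \sum_(j < n | (i != j) && ~~ e i j)
          c i j * ('X_i * 'X_j).

Section Resolutions.
Variables (k : fieldType) (n : nat).
Notation S := {mpoly k[n]}.

(* The data of a sequence ... -> F_1 -> F_0 -> S, where
   F_i = \bigoplus_(a < fr_rank i) S(- fr_deg a) consists of row vectors and the
   maps are right multiplications: v |-> v *m fr_diff i from F_(i+1) to F_i, and
   v |-> v *m fr_aug from F_0 to S. *)
Record free_seq := FreeSeq {
  fr_rank : nat -> nat;
  fr_deg : forall i, 'I_(fr_rank i) -> nat;
  fr_diff : forall i, 'M[S]_(fr_rank i.+1, fr_rank i);
  fr_aug : 'cV[S]_(fr_rank 0)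
}.

(* The maps have degree 0 for the grading in which the a-th basis vector of F_i
   has degree [fr_deg a]. *)
Definition fr_graded (F : free_seq) : Prop :=
  (forall a, fr_aug F a 0 \is (fr_deg a).-homog) /\
  (forall i a b m, m \in msupp (fr_diff F i a b) ->
     mdeg m + fr_deg b = fr_deg a)%N.

Definition fr_exact (I : S -> Prop) (F : free_seq) : Prop :=
  [/\ forall p, I p <-> exists v : 'rV[S]_(fr_rank F 0),
                          p = (v *m fr_aug F) 0 0,
      forall v : 'rV[S]_(fr_rank F 0),
        v *m fr_aug F = 0 <-> exists w, v = w *m fr_diff F 0
    & forall i (v : 'rV[S]_(fr_rank F i.+1)),
        v *m fr_diff F i = 0 <-> exists w, v = w *m fr_diff F i.+1].

(* The image of F_(i+1) lies in (x_1, ..., x_n) F_i. *)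
Definition fr_minimal (F : free_seq) : Prop :=
  forall i a b, (fr_diff F i a b)@_0%MM = 0.

Definition minimal_graded_free_resolution (I : S -> Prop) (F : free_seq) :
  Prop := [/\ fr_graded F, fr_exact I F & fr_minimal F].

Definition zero_free_seq : free_seq :=
  @FreeSeq (fun=> 0%N) (fun _ _ => 0%N) (fun=> 0) 0.

(* A homogeneous ideal has a minimal graded free resolution, unique up to
   isomorphism; [the_resolution I] is one of them. *)
Definition the_resolution (I : S -> Prop) : free_seq :=
  epsilon (inhabits zero_free_seq) (minimal_graded_free_resolution I).

Definition graded_betti (I : S -> Prop) (i j : nat) : nat :=
  #|[set a : 'I_(fr_rank (the_resolution I) i) | fr_deg a == j]|.

End Resolutions.

Definition is_max (P : nat -> Prop) (r : nat) : Prop :=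
  P r /\ forall s, P s -> (s <= r)%N.

(* [epsilon] is unspecified when there is no maximum, so proving a bound on [reg]
   requires proving that the maximum exists. *)
Definition reg (k : fieldType) (n : nat) (e : rel 'I_n) : nat :=
  if excluded_middle_informative (complete_graph e) then 1%N
  else epsilon (inhabits 0%N)
         (is_max (fun r =>
            exists i, graded_betti (@nonedge_ideal k n e) i (i + r) <> 0%N)).

(* Main.v *)
Require Import Defs.
From Stdlib Require Import ClassicalEpsilon.
From mathcomp Require Import all_boot all_order all_algebra.
From mathcomp Require Import mpoly.
From mathcomp Require Import zify ring.

(** For a set W of vertices let J_W be the ideal spanned by the monomials whose
    support is not a clique contained in W. If v is in W and N[v] denotes the
    closed neighbourhood of v in W, then J_W : x_v = J_N[v] and
    (J_W, x_v) = J_(W \ v), so that reg J_W <= max (reg J_N[v] + 1) (reg J_(W \ v)).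
    If W is a clique, J_W is generated by variables and has regularity at most 1.
    Hence the regularity is at most 2 if W contains no hole, since then some v has
    a clique as neighbourhood, and at most 3 if the graph is even-hole free, since
    then some v has a neighbourhood without holes. Both vertices v come from the
    same extremal choice of a vertex v and a connected set C anticomplete to v; the
    even-hole free case rests on the fact that a hole H all of whose vertices are
    adjacent to x always has a vertex without neighbours in a given connected set
    C anticomplete to x, which follows from a parity analysis of the way a path of
    C is attached to H.

    Regularity bounds are vanishing statements about the Koszul homology of the
    ideal, computed with the exactness of the Koszul complex of the polynomial
    ring (Cartan's homotopy, available in characteristic 0). Along a minimal
    resolution the Koszul homology of a syzygy module is, up to a shift, a quotient
    of that of the previous one, and in homological degree 0 it sees the degrees of
    the minimal generators. The same vanishing bounds the degrees of generators of
    every syzygy module, which makes these modules finitely generated and hence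
    provides the minimal resolution. *)

Set Implicit Arguments.
Unset Strict Implicit.
Unset Printing Implicit Defensive.

Import GRing.Theory.

(** * Paths and holes *)

Lemma ex_least (P : nat -> Prop) :
  (exists m, P m) -> exists m, P m /\ forall m', P m' -> m <= m'.
Proof.
move=> [m]; elim/ltn_ind: m => m IH Pm.
have [[m' [lt_m' Pm']]|no] := classic (exists m', m' < m /\ P m').
  exact: IH lt_m' Pm'.
exists m; split=> // m' Pm'; rewrite leqNgt; apply/negP => lt_m'.
by apply: no; exists m'.
Qed.

(* Indices 0, ..., l - 1 are positions on a cycle of length l. *)
Definition cadj l i j :=
  [|| j == i.+1, i == j.+1, (i == 0) && (j == l.-1) | (j == 0) && (i == l.-1)].

(** Rotation of positions by [r]; for [r] and [i] below [l] one subtraction suffices. *)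
Definition cshift l r i := if r + i < l then r + i else r + i - l.

(** The number of forward steps from [i] to [j] around the cycle. *)
Definition cdist l i j := if i <= j then j - i else j + l - i.

Lemma cadjC l i j : cadj l i j = cadj l j i.
Proof. by rewrite /cadj; lia. Qed.

Lemma cshift_lt l r i : r < l -> i < l -> cshift l r i < l.
Proof. by rewrite /cshift; case: (ltnP (r + i) l) => ?; lia. Qed.

Lemma cshift0 l r : r < l -> cshift l r 0 = r.
Proof. by rewrite /cshift; case: (ltnP (r + 0) l) => ?; lia. Qed.

Lemma eq_cshift l r i j : r < l -> i < l -> j < l ->
  (cshift l r i == cshift l r j) = (i == j).
Proof.
by rewrite /cshift; case: (ltnP (r + i) l) => ?; case: (ltnP (r + j) l) => ?; lia.
Qed.

Lemma cadj_cshift l r i j : r < l -> i < l -> j < l ->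
  cadj l (cshift l r i) (cshift l r j) = cadj l i j.
Proof.
rewrite /cshift /cadj.
by case: (ltnP (r + i) l) => ?; case: (ltnP (r + j) l) => ?; lia.
Qed.

Lemma cdist_lt l i j : i < l -> j < l -> cdist l i j < l.
Proof. by rewrite /cdist; case: (leqP i j) => ?; lia. Qed.

Lemma cshift_cdist l i j : i < l -> j < l -> cshift l i (cdist l i j) = j.
Proof.
rewrite /cdist /cshift; case: (leqP i j) => ?.
  by case: (ltnP (i + (j - i)) l) => ?; lia.
by case: (ltnP (i + (j + l - i)) l) => ?; lia.
Qed.

Lemma cdist_far l i j : i < l -> j < l -> i != j -> ~~ cadj l i j ->
  1 < cdist l i j /\ cdist l i j < l.-1.
Proof. by rewrite /cdist /cadj; case: (leqP i j) => ?; lia. Qed.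

Lemma cadj_succ l i j : i < l -> j < l -> cadj l i j -> 1 < l ->
  j = cshift l i 1 \/ i = cshift l j 1.
Proof.
rewrite /cshift /cadj.
by case: (ltnP (i + 1) l) => ?; case: (ltnP (j + 1) l) => ?; lia.
Qed.

Section InducedCycles.
Variables (n : nat) (e : rel 'I_n).
Hypotheses (e_sym : ssrbool.symmetric e) (e_irr : irreflexive e).

(** Only the values of [p] below [k] matter; segments and reversals of induced paths then become
    arithmetic on indices. *)
Definition ipath (k : nat) (p : nat -> 'I_n) : Prop :=
  forall i j, i < j -> j < k -> p i != p j /\ e (p i) (p j) = (j == i.+1).

Definition ihole (l : nat) (h : nat -> 'I_n) : Prop :=
  4 <= l /\ forall i j, i < j -> j < l ->
    h i != h j /\ e (h i) (h j) = (j == i.+1) || ((i == 0) && (j == l.-1)).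

Lemma next_nth_uniq (T : eqType) (x0 : T) (c : seq T) i :
  uniq c -> i < size c ->
  next c (nth x0 c i) = nth x0 c (if i.+1 == size c then 0 else i.+1).
Proof.
move=> Uc lti; rewrite next_nth mem_nth //.
case: c Uc lti => // y c Uc lti; rewrite index_uniq //.
case: eqP => [[E]|/eqP ne].
  by rewrite nth_default ?E.
have lt : i < size c by move: lti ne => /=; lia.
by rewrite /=; apply: set_nth_default.
Qed.

Lemma ihole_neq l h i j : ihole l h -> i < l -> j < l -> (h i == h j) = (i == j).
Proof.
move=> [_ H] li lj; case: (ltngtP i j) => [lt|lt|->]; last exact: eqxx.
  by apply/negbTE; case: (H _ _ lt lj).
by rewrite eq_sym; apply/negbTE; case: (H _ _ lt li).
Qed.

Lemma ihole_is_hole l h : ihole l h -> is_hole e (mkseq h l).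
Proof.
move=> Hh; have [l4 H] := Hh.
have U : uniq (mkseq h l).
  apply/mkseq_uniqP => i j; rewrite !inE => li lj /eqP.
  by rewrite (ihole_neq Hh) // => /eqP.
have nextE i : i < l -> next (mkseq h l) (h i) = h (if i.+1 == l then 0 else i.+1).
  move=> li; rewrite -{1}(nth_mkseq (h 0) h li) next_nth_uniq ?size_mkseq //.
  by rewrite nth_mkseq //; case: eqP => ?; lia.
split; first by rewrite size_mkseq.
  rewrite /ucycle U andbT; apply: cycle_from_next => // x /mapP[i].
  rewrite mem_iota => /andP[_ li] ->; rewrite nextE //.
  case: eqP => [E|ne].
    by rewrite e_sym; case: (H 0 i) => [||_ ->]; lia.
  by case: (H i i.+1) => [||_ ->]; lia.
move=> x y /mapP[i]; rewrite mem_iota => /andP[_ li] ->.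
move=> /mapP[j]; rewrite mem_iota => /andP[_ lj] -> eij.
rewrite !nextE // !(ihole_neq Hh) //; try by (case: eqP; lia).
case: (ltngtP i j) => [lt|lt|E].
- by case: (H i j) => // _; rewrite eij => /esym; case: (i.+1 =P l); case: (j.+1 =P l); lia.
- by case: (H j i) => // _; rewrite e_sym eij => /esym; case: (i.+1 =P l); case: (j.+1 =P l); lia.
- by rewrite E e_irr in eij.
Qed.

(** Walk along [p] and return along [s]: the paths are linked only at their first and at their last
    vertices, so the closed walk has no chord. *)
Lemma glue k p l s : ipath k p -> ipath l s -> 0 < k -> 0 < l -> 4 <= k + l ->
  (forall i j, i < k -> j < l -> p i != s j /\
     e (p i) (s j) = ((i == 0) && (j == 0)) || ((i == k.-1) && (j == l.-1))) ->
  ihole (k + l) (fun i => if i < k then p i else s ((k + l).-1 - i)).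
Proof.
move=> Hp Hs k0 l0 kl4 ps; split=> // i j ij jl.
case: ltnP => ik; case: ltnP => jk; last 1 first.
- by rewrite eq_sym e_sym; case: (Hs ((k + l).-1 - j) ((k + l).-1 - i)) => [||-> ->]; lia.
- by case: (Hp i j) => // -> ->; lia.
- by case: (ps i ((k + l).-1 - j)) => [||-> ->]; lia.
- by lia.
Qed.

Lemma ihole_C4 a b c d : a != c -> b != d -> e a b -> e b c -> e c d -> e d a ->
  ~~ e a c -> ~~ e b d -> ihole 4 (nth a [:: a; b; c; d]).
Proof.
move=> ac bd ab bc cd da nac nbd.
have neq x y : e x y -> x != y by apply: contraTneq => ->; rewrite e_irr.
split=> // i j.
have := (neq _ _ ab, neq _ _ bc, neq _ _ cd, neq _ _ da) => nn.
have ad : e a d by rewrite e_sym.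
have nad : a != d by apply: neq.
case: i => [|[|[|i]]]; case: j => [|[|[|[|j]]]] //= _ _;
  rewrite ?nn ?ab ?bc ?cd ?ad ?nad ?ac ?bd ?(negbTE nac) ?(negbTE nbd) //.
Qed.

Hypothesis ehf : even_hole_free e.

Lemma ihole_odd l h : ihole l h -> odd l.
Proof. by move=> Hh; rewrite -(size_mkseq h l); apply/ehf/ihole_is_hole. Qed.

Lemma glue_odd k p l s : ipath k p -> ipath l s -> 0 < k -> 0 < l -> 4 <= k + l ->
  (forall i j, i < k -> j < l -> p i != s j /\
     e (p i) (s j) = ((i == 0) && (j == 0)) || ((i == k.-1) && (j == l.-1))) ->
  odd (k + l).
Proof. by move=> Hp Hs k0 l0 kl ps; apply: ihole_odd (glue Hp Hs k0 l0 kl ps). Qed.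

Lemma no_C4 a b c d : a != c -> b != d -> e a b -> e b c -> e c d -> e d a ->
  ~~ e a c -> ~~ e b d -> False.
Proof.
move=> ac bd ab bc cd da nac nbd.
by have := ihole_odd (ihole_C4 ac bd ab bc cd da nac nbd).
Qed.

Lemma ipath_shift k p t k' : ipath k p -> t + k' <= k -> ipath k' (fun i => p (t + i)).
Proof. by move=> H le i j ij jk; case: (H (t + i) (t + j)) => [||-> ->]; lia. Qed.

Lemma ihole_rot l h r : ihole l h -> r < l -> ihole l (fun i => h (cshift l r i)).
Proof.
move=> [l4 H] rl; split=> // i j ij jl; rewrite /cshift.
case: ltnP => i1; case: ltnP => j1.
- by case: (H (r + i) (r + j)) => [||-> ->]; lia.
- by rewrite eq_sym e_sym; case: (H (r + j - l) (r + i)) => [||-> ->]; lia.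
- by lia.
- by case: (H (r + i - l) (r + j - l)) => [||-> ->]; lia.
Qed.

Lemma ihole_rev l h : ihole l h -> ihole l (fun i => h (l.-1 - i)).
Proof.
move=> [l4 H]; split=> // i j ij jl.
by rewrite eq_sym e_sym; case: (H (l.-1 - j) (l.-1 - i)) => [||-> ->]; lia.
Qed.

End InducedCycles.

(** * Paths of a connected set attached to the rim of a wheel *)

Section Attachments.
Variables (n : nat) (e : rel 'I_n).
Hypotheses (e_sym : ssrbool.symmetric e) (e_irr : irreflexive e).

Definition connected (C : {set 'I_n}) : Prop :=
  {in C &, forall c c', connect (fun u v => [&& e u v, u \in C & v \in C]) c c'}.

Definition path_in (C : {set 'I_n}) k p :=
  [/\ 0 < k, ipath e k p & forall t, t < k -> p t \in C].

(** Take a shortest walk in [C] with [R]-related ends: a repetition or a chord would give a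
    shortcut, and a proper segment with related ends would be shorter. The ends found need not be
    [c] and [c']. *)
Lemma shortest_path C (R : 'I_n -> 'I_n -> Prop) c c' :
  connected C -> c \in C -> c' \in C -> R c c' ->
  exists k p, [/\ path_in C k p, R (p 0) (p k.-1) &
    forall s t, s <= t -> t < k -> R (p s) (p t) -> s = 0 /\ t = k.-1].
Proof.
move=> connC Cc Cc' Rcc'.
pose W k := exists p : nat -> 'I_n, [/\ 0 < k, forall t, t < k -> p t \in C,
  forall t, t.+1 < k -> e (p t) (p t.+1) & R (p 0) (p k.-1)].
have [k [[p [k0 pC pe Rp]] kmin]] : exists k, W k /\ forall k', W k' -> k <= k'.
  apply: ex_least; case/connectP: (connC _ _ Cc Cc') => s sp c'E.
  exists (size s).+1, (nth c (c :: s)); split=> //.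
  - case=> [|t] //; rewrite ltnS => ts /=.
    by move/(pathP c)/(_ _ ts)/and3P: sp => [].
  - by move=> t; rewrite ltnS => ts; move/(pathP c)/(_ _ ts)/and3P: sp => [].
  - by rewrite nth_last /= -c'E.
exists k, p; split=> //.
- split=> // i j ij jk; split.
    apply/negP => /eqP pij.
    suff /kmin : W (k - (j - i)) by lia.
    (* The positions [i] to [j - 1] are dropped, since [p i = p j]. *)
    exists (fun t => if t < i then p t else p (t + (j - i))); split=> //; first by lia.
    + by move=> t lt; case: ltnP => ?; apply: pC; lia.
    + move=> t lt; case: ltnP => a; case: ltnP => b; try lia.
      * by apply: pe; lia.
      * have -> : t.+1 + (j - i) = j by lia.
        by rewrite -pij (_ : i = t.+1); [apply: pe; lia|lia].
      * by rewrite addSn; apply: pe; lia.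
    + rewrite (_ : (if 0 < i then p 0 else p (0 + (j - i))) = p 0); last first.
        by case: posnP => // i0; rewrite add0n i0 subn0 -pij i0.
      by case: ltnP => lt; [lia|rewrite (_ : _ + _ = k.-1) //; lia].
  apply/idP/eqP => [eij|->]; last by apply: pe; lia.
  apply/eqP; rewrite eqn_leq ij andbT leqNgt; apply/negP => lt.
  suff /kmin : W (k - (j - i.+1)) by lia.
  (* The chord bypasses the positions [i + 1] to [j - 1]. *)
  exists (fun t => if t <= i then p t else p (t + (j - i.+1))); split=> //; first by lia.
  - by move=> t tk; case: leqP => ?; apply: pC; lia.
  - move=> t tk; case: (ltngtP t i) => a.
    + by apply: pe; lia.
    + by rewrite addSn; apply: pe; lia.
    + by rewrite a subnKC.
  - by rewrite leq0n; case: leqP => a; [lia|rewrite (_ : _ + _ = k.-1) //; lia].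
- move=> s t st tk Rst.
  suff /kmin : W (t - s).+1 by lia.
  exists (fun u => p (s + u)); split=> //=.
  + by move=> u lu; apply: pC; lia.
  + by move=> u lu; rewrite addnS; apply: pe; lia.
  + by rewrite addn0 subnKC.
Qed.

Hypothesis ehf : even_hole_free e.

Variables (x : 'I_n) (C : {set 'I_n}) (l : nat).
Hypotheses (connC : connected C) (xC : forall c, c \in C -> c != x /\ ~~ e x c).

Notation adjl := (cadj l).

(** A hole complete to the hub [x], that is, the rim of a universal wheel. *)
Definition rim h := ihole e l h /\ forall i, i < l -> e x (h i).

Lemma rim_odd h : rim h -> odd l.
Proof. by case=> Hh _; apply: (ihole_odd e_sym e_irr ehf Hh). Qed.

Lemma rim_adj h i j : rim h -> i < l -> j < l -> e (h i) (h j) = adjl i j.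
Proof.
move=> [[l4 H] _] il jl; rewrite /cadj; case: (ltngtP i j) => [lt|lt|<-].
- by case: (H _ _ lt jl) => _ ->; lia.
- by rewrite e_sym; case: (H _ _ lt il) => _ ->; lia.
- by rewrite e_irr; lia.
Qed.

Lemma rim_neq h i j : rim h -> i < l -> j < l -> (h i == h j) = (i == j).
Proof. by move=> [Hh _] il jl; rewrite (ihole_neq Hh). Qed.

Lemma rim_notin h i c : rim h -> i < l -> c \in C -> c != h i.
Proof.
by move=> [_ H] il /xC[_]; apply: contraNneq => ->; apply: H.
Qed.

(** Two nonadjacent rim neighbours of [c] would form an induced 4-cycle with [c] and the hub. *)
Lemma attach_clique h c i j : rim h -> c \in C -> i < l -> j < l ->
  e c (h i) -> e c (h j) -> i != j -> adjl i j.
Proof.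
move=> Hh Cc il jl ei ej ij; rewrite -(rim_adj Hh) //; apply: contraT => nadj.
have [cx xc] := xC Cc; have [_ xh] := Hh.
exfalso; apply: (@no_C4 _ _ e_sym e_irr ehf (h i) x (h j) c) => //.
- by rewrite rim_neq.
- by rewrite eq_sym.
- by rewrite e_sym xh.
- exact: xh.
- by rewrite e_sym.
Qed.

Lemma rim_rot h r : rim h -> r < l -> rim (fun i => h (cshift l r i)).
Proof.
move=> [H xh] rl; split; first exact: ihole_rot.
by move=> i il; apply: xh; apply: cshift_lt.
Qed.

Lemma rim_rev h : rim h -> rim (fun i => h (l.-1 - i)).
Proof.
move=> [H xh]; split; first exact: ihole_rev.
by move=> i il; apply: xh; lia.
Qed.

(* The hole x, h_u, p, h_v shows that k is even; then p and the arc of the hole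
   from lo to hi form an even hole. *)
Lemma two_arcs h k p u v lo hi : rim h -> path_in C k p ->
  u < l -> v < l -> u != v -> ~~ adjl u v ->
  (forall t, t < k -> e (p t) (h u) = (t == 0)) ->
  (forall t, t < k -> e (p t) (h v) = (t == k.-1)) ->
  lo < hi -> hi < l -> odd (hi - lo) ->
  (forall t i, t < k -> lo < i -> i < hi -> ~~ e (p t) (h i)) ->
  (forall t, t < k -> e (p t) (h lo) = (t == 0)) /\
  (forall t, t < k -> e (p t) (h hi) = (t == k.-1)) \/
  (forall t, t < k -> e (p t) (h lo) = (t == k.-1)) /\
  (forall t, t < k -> e (p t) (h hi) = (t == 0)) ->
  False.
Proof.
move=> Hh [k0 ip pC] ul vl uv nuv pu pv lohi hil oddlh clean ends.
have [[l4 ih] xh] := Hh; have lodd := rim_odd Hh.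
have xneq i : i < l -> h i != x.
  by move=> il; apply: contraTneq (xh _ il) => ->; rewrite e_irr.
have keven : odd (k + 3).
  apply: (@glue_odd _ _ e_sym e_irr ehf k p 3 (nth x [:: h u; x; h v])) => //; try by lia.
    have nuve : e (h u) (h v) = false by rewrite (rim_adj Hh) //; apply/negbTE.
    move=> i j; case: i => [|[|[|i]]]; case: j => [|[|[|j]]] //= _ _.
    - by rewrite xneq // e_sym xh.
    - by rewrite (rim_neq Hh) // uv nuve.
    - by rewrite eq_sym xneq // xh.
  move=> i j ik j3; have [px xp] := xC (pC _ ik).
  case: j j3 => [|[|[|j]]] //= _.
  - by rewrite (rim_notin Hh) ?pC // pu //; split=> //; rewrite andbT andbF orbF.
  - by rewrite px e_sym (negbTE xp); split=> //; rewrite andbF andbF.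
  - by rewrite (rim_notin Hh) ?pC // pv //; split=> //; rewrite andbT andbF.
have [[plo phi]|[plo phi]] := ends.
- suff : odd (k + (hi - lo).+1) by lia.
  apply: (@glue_odd _ _ e_sym e_irr ehf k p _ (fun i => h (lo + i))) => //; try by lia.
    by move=> i j ij jl; case: (ih (lo + i) (lo + j)) => [||-> ->]; lia.
  move=> i j ik jl; rewrite (rim_notin Hh) ?pC //; last by lia.
  split=> //; case: (posnP j) => [->|j0].
    by rewrite addn0 plo //; lia.
  case: (ltnP (lo + j) hi) => jh; first by rewrite (negbTE (clean _ _ _ _ _)) //; lia.
  by rewrite (_ : lo + j = hi) ?phi //; lia.
- suff : odd (k + (hi - lo).+1) by lia.
  apply: (@glue_odd _ _ e_sym e_irr ehf k p _ (fun i => h (hi - i))) => //; try by lia.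
    by move=> i j ij jl; rewrite eq_sym e_sym; case: (ih (hi - j) (hi - i)) => [||-> ->]; lia.
  move=> i j ik jl; rewrite (rim_notin Hh) ?pC //; last by lia.
  split=> //; case: (posnP j) => [->|j0].
    by rewrite subn0 phi //; lia.
  case: (ltnP lo (hi - j)) => jh; first by rewrite (negbTE (clean _ _ _ _ _)) //; lia.
  by rewrite (_ : hi - j = lo) ?plo //; lia.
Qed.


(** On the segment of [p] from [r] to [y], only [p r] sees [h g]; [at_last] asks the same of [p y].
    These are the end conditions of [two_arcs] on a segment. *)
Definition at_first (p h : nat -> 'I_n) r y g :=
  e (p r) (h g) /\ forall t, r < t -> t <= y -> ~~ e (p t) (h g).

Definition at_last (p h : nat -> 'I_n) r y g :=
  e (p y) (h g) /\ forall t, r <= t -> t < y -> ~~ e (p t) (h g).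

Lemma two_arcs_seg h k p r y u v lo hi : rim h -> path_in C k p ->
  r <= y -> y < k -> u < l -> v < l -> u != v -> ~~ adjl u v ->
  at_first p h r y u -> at_last p h r y v -> lo < hi -> hi < l -> odd (hi - lo) ->
  (forall t i, r <= t -> t <= y -> lo < i -> i < hi -> ~~ e (p t) (h i)) ->
  at_first p h r y lo /\ at_last p h r y hi \/
  at_last p h r y lo /\ at_first p h r y hi ->
  False.
Proof.
move=> Hh [k0 ip pC] ry yk ul vl uv nuv pu pv lohi hil oddlh clean ends.
have fst_at g : at_first p h r y g ->
    forall t, t < (y - r).+1 -> e (p (r + t)) (h g) = (t == 0).
  move=> [p0 pt] [|t] lt; first by rewrite addn0 p0.
  by apply/negbTE/pt; lia.
have lst_at g : at_last p h r y g ->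
    forall t, t < (y - r).+1 -> e (p (r + t)) (h g) = (t == (y - r).+1.-1).
  move=> [p0 pt] t lt; case: eqP => E; first by rewrite E /= subnKC.
  by apply/negbTE/pt; move: E => /=; lia.
have ps : path_in C (y - r).+1 (fun t => p (r + t)).
  split=> // [|t lt]; last by apply: pC; lia.
  by apply: (ipath_shift ip); lia.
apply: (two_arcs Hh ps ul vl uv nuv (fst_at _ pu) (lst_at _ pv) lohi hil oddlh).
  by move=> t i lt; apply: clean; lia.
by case: ends => -[p1 p2]; [left|right]; split; do ?[exact: fst_at|exact: lst_at].
Qed.

(** As [l] is odd, exactly one of the two arcs between [0] and [d] is odd. A common neighbour of
    [h 0] and [h d] lies inside an arc of length two, so the odd arc has no attachment inside and
    [two_arcs] applies. *)
Lemma far_ends h k p d : rim h -> path_in C k p -> 1 < d -> d < l.-1 ->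
  (forall t, t < k -> e (p t) (h 0) = (t == 0)) ->
  (forall t, t < k -> e (p t) (h d) = (t == k.-1)) ->
  (forall t i, t < k -> i < l -> e (p t) (h i) -> i != 0 -> i != d ->
     adjl i 0 && adjl i d) -> False.
Proof.
move=> Hh pp d1 dl p0 pd inner; have lodd := rim_odd Hh.
have [k0 _ _] := pp.
have [dodd|deven] := boolP (odd d).
  apply: (@two_arcs h k p 0 d 0 d) => //; try by rewrite /cadj; lia.
    move=> t i tk i0 id; apply/negP => /inner; rewrite /cadj; lia.
  by left.
have dl' : d < l by lia.
have d0E : cshift l d 0 = d by apply: cshift0; lia.
have deE : cshift l d (l - d) = 0 by rewrite /cshift subnKC ?ltnn ?subnn // ltnW.
(* Rotating by [d] moves the other arc to the positions [0] to [l - d]; position [0] is then seen by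
   the last vertex of the path. *)
have Hd : rim (fun i => h (cshift l d i)) by apply: rim_rot.
apply: (@two_arcs (fun i => h (cshift l d i)) k p (l - d) 0 0 (l - d)); rewrite ?d0E ?deE //.
- by lia.
- by lia.
- by lia.
- by rewrite /cadj; lia.
- by lia.
- by lia.
- by lia.
- move=> t i tk i0 id; rewrite /cshift.
  by case: (ltnP (d + i) l) => lt; apply/negP => /inner; rewrite /cadj; lia.
by right.
Qed.

(** If no vertex of [C] sees two rim vertices, a shortest path of [C] between attachments to
    nonadjacent rim vertices contradicts [far_ends]. Otherwise the two rim vertices seen are
    consecutive, and a rotation puts them at [l - 1] and [0]. *)
Lemma exists_edge_attached h : rim h ->
  (forall i, i < l -> exists2 c, c \in C & e c (h i)) ->
  exists h', [/\ rim h', (forall i, i < l -> exists2 c, c \in C & e c (h' i)) &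
    exists2 c, c \in C & e c (h' 0) /\ e c (h' l.-1)].
Proof.
move=> Hh att; have [[l4 _] _] := Hh; have lodd := rim_odd Hh.
have [[c [i [j [Cc il jl ij [ei ej]]]]]|noedge] := classic (exists c i j,
    [/\ c \in C, i < l, j < l, i != j & e c (h i) /\ e c (h j)]).
  have [r [rl e1 e2]] : exists r, [/\ r < l, e c (h r) & e c (h (cshift l r 1))].
    have := attach_clique Hh Cc il jl ei ej ij.
    by move=> /(cadj_succ il jl)/(_ (ltnW (ltnW l4)))[] E;
      [exists i|exists j]; rewrite -E.
  have r'l : cshift l r 1 < l by apply: cshift_lt => //; lia.
  exists (fun i => h (cshift l (cshift l r 1) i)); split; first exact: rim_rot.
    by move=> i' i'l; apply: att; apply: cshift_lt.
  exists c => //; rewrite cshift0 //; split=> //.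
  suff -> : cshift l (cshift l r 1) l.-1 = r by [].
  clear -rl l4; rewrite /cshift; case: (ltnP (r + 1) l) => ?.
    by case: (ltnP (r + 1 + l.-1) l) => ?; lia.
  by case: (ltnP (r + 1 - l + l.-1) l) => ?; lia.
exfalso; pose R c c' := exists i j,
  [/\ i < l, j < l, i != j, ~~ adjl i j & e c (h i) /\ e c' (h j)].
have [c0 C0 e0] := att 0 (ltnW (ltnW (ltnW l4))).
have [c2 C2 e2] := att 2 (ltnW l4).
have [|k [p [pp [i [j [il jl ij nij [ei ej]]]] pmin]]] :=
    @shortest_path C R c0 c2 connC C0 C2.
  by exists 0, 2; split; rewrite // /cadj; lia.
have [k0 ip pC] := pp.
have single t g g' : t < k -> g < l -> g' < l -> e (p t) (h g) -> e (p t) (h g') -> g = g'.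
  move=> tk gl gl' eg eg'; apply/eqP; apply: contraT => ne; case: noedge.
  by exists (p t), g, g'; split=> //; apply: pC.
have ati t : t < k -> e (p t) (h i) -> t = 0.
  move=> tk et; have rij : R (p t) (p k.-1) by exists i, j.
  by case: (pmin t k.-1 _ _ rij) => //; rewrite -1?ltnS prednK.
have atj t : t < k -> e (p t) (h j) -> t = k.-1.
  move=> tk et; have rij : R (p 0) (p t) by exists i, j.
  by case: (pmin 0 t _ _ rij).
pose d := cdist l i j; have dl : d < l by apply: cdist_lt.
have l0 : 0 < l by apply: leq_ltn_trans il.
have [d1 dl1] : 1 < d /\ d < l.-1 by apply: cdist_far.
have dE : cshift l i d = j by apply: cshift_cdist.
have i0E : cshift l i 0 = i by apply: cshift0.
apply: (@far_ends (fun g => h (cshift l i g)) k p d); rewrite ?dE ?i0E //.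
- exact: rim_rot.
- by move=> t tk; apply/idP/eqP => [/ati|-> //]; apply.
- by move=> t tk; apply/idP/eqP => [/atj|-> //]; apply.
(* Any further attachment [g'] is adjacent to both [i] and [j], since otherwise a proper segment of
   the path would join nonadjacent attachments. *)
move=> t g tk gl; set g' := cshift l i g => eg g0 gd.
have gl' : g' < l by apply: cshift_lt.
have gi : g' != i by rewrite -i0E eq_cshift.
have gj : g' != j by rewrite -dE eq_cshift.
have t0 : t != 0 by apply: contraNneq gi => E; rewrite (single t g' i) // E.
have tk1 : t != k.-1 by apply: contraNneq gj => E; rewrite (single t g' j) // E.
rewrite -(cadj_cshift il gl l0) -(cadj_cshift il gl dl) i0E dE -/g'.
apply/andP; split.
  rewrite cadjC; apply: contraT => nc; have rig : R (p 0) (p t).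
    by exists i, g'; split=> //; rewrite eq_sym.
  by case: (pmin 0 t _ _ rig) => // _ tE; rewrite tE eqxx in tk1.
apply: contraT => nc; have rgj : R (p t) (p k.-1) by exists g', j.
case: (pmin t k.-1 _ _ rgj) => [||tE _]; last by rewrite tE in t0.
  by rewrite -ltnS prednK.
by rewrite prednK.
Qed.

End Attachments.

(** * Vertices of a universal wheel attached to a connected set *)

Lemma last_before (P : pred nat) r i :
  (forall t, r < t -> t <= i -> ~~ P t) \/
  exists s, [/\ r < s, s <= i, P s & forall t, s < t -> t <= i -> ~~ P t].
Proof.
elim: i => [|i [IH|[s [rs si Ps IH]]]]; first by left; lia.
  have [Pi|nPi] := boolP (P i.+1); last first.
    by left=> t rt; rewrite leq_eqVlt => /predU1P[->//|]; apply: IH.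
  have [ri|ri] := ltnP r i.+1; last by left; lia.
  by right; exists i.+1; split=> //; lia.
have [Pi|nPi] := boolP (P i.+1).
  by right; exists i.+1; split=> //; lia.
right; exists s; split=> //; first by lia.
by move=> t st; rewrite leq_eqVlt => /predU1P[->//|]; apply: IH.
Qed.

Section Walk.
Variables (n : nat) (e : rel 'I_n).
Hypotheses (e_sym : ssrbool.symmetric e) (e_irr : irreflexive e).
Hypothesis ehf : even_hole_free e.
Variables (x : 'I_n) (C : {set 'I_n}) (l : nat).
Hypotheses (connC : connected e C) (xC : forall c, c \in C -> c != x /\ ~~ e x c).
Notation rim := (rim e x l).
Notation adjl := (cadj l).

Section Path.
Variables (k : nat) (p : nat -> 'I_n).
Hypothesis pp : path_in e C k p.

Lemma path_clique h t i j : rim h -> t < k -> i < l -> j < l ->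
  e (p t) (h i) -> e (p t) (h j) -> i != j -> adjl i j.
Proof. by case: pp => _ _ pC Hh tk; apply: (attach_clique e_sym e_irr ehf xC) => //; apply: pC. Qed.

(** The segment between two successive attachments satisfies [far_ends]; so single attachments
    cannot move directly to a nonadjacent rim vertex. *)
Lemma no_jump h s t a b : rim h -> s < t -> t < k -> a < l -> b < l ->
  a != b -> ~~ adjl a b -> e (p s) (h a) -> e (p t) (h b) ->
  (forall g, g < l -> e (p s) (h g) -> g = a) ->
  (forall g, g < l -> e (p t) (h g) -> g = b) ->
  (forall u g, s < u -> u < t -> g < l -> ~~ e (p u) (h g)) -> False.
Proof.
move=> Hh st tk al bl ab nab ea eb oa ob clean.
have lodd := rim_odd e_sym e_irr ehf Hh; have [[l4 _] _] := Hh.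
have [k0 ip pC] := pp.
pose d := cdist l a b; have dl : d < l by apply: cdist_lt.
have l0 : 0 < l by apply: leq_ltn_trans al.
have [d1 dl1] : 1 < d /\ d < l.-1 by apply: cdist_far.
have dE : cshift l a d = b by apply: cshift_cdist.
have a0E : cshift l a 0 = a by apply: cshift0.
have stE : s + (t - s) = t by rewrite subnKC // ltnW.
have ps : path_in e C (t - s).+1 (fun u => p (s + u)).
  split=> // [|u lt]; last by apply: pC; apply: leq_ltn_trans tk; rewrite -stE leq_add2l.
  by apply: (ipath_shift ip); rewrite addnS stE.
have mid u g : 0 < u -> u < t - s -> g < l -> e (p (s + u)) (h g) = false.
  move=> u0 ut gl; apply/negbTE/clean => //; first by rewrite -[s.+1]addn1 leq_add2l.
  by rewrite -stE ltn_add2l.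
have fst_ u g : u < (t - s).+1 -> g < l -> e (p (s + u)) (h g) -> g != b -> u = 0 /\ g = a.
  move=> ut gl; case: (posnP u) => [->|u0]; first by rewrite addn0 => /oa->.
  move: ut; rewrite ltnS leq_eqVlt => /predU1P[->|ut]; last by rewrite mid.
  by rewrite stE => /ob->; rewrite ?eqxx.
have lst_ u g : u < (t - s).+1 -> g < l -> e (p (s + u)) (h g) -> g != a -> u = t - s /\ g = b.
  move=> ut gl eg ga; have [gb|/(fst_ _ _ ut gl eg)[_ E]] := eqVneq g b; last by rewrite E eqxx in ga.
  split=> //; move: ut; rewrite ltnS leq_eqVlt => /predU1P[//|ut].
  case: (posnP u) => [u0|u0]; last by rewrite mid in eg.
  by move: eg; rewrite u0 addn0 => /oa E; rewrite E ?eqxx in ga.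
apply: (@far_ends _ _ e_sym e_irr ehf x C l xC (fun g => h (cshift l a g)) _ _ d _ ps);
  rewrite ?dE ?a0E //.
- exact: (rim_rot e_sym).
- move=> u uk; apply/idP/eqP => [eu|->]; last by rewrite addn0.
  by case: (fst_ _ _ uk al eu ab).
- move=> u uk; apply/idP/eqP => [eu|->]; last by rewrite stE.
  by case: (lst_ _ _ uk bl eu); rewrite // eq_sym.
move=> u g uk gl eg g0 gd; exfalso.
have gl' : cshift l a g < l by apply: cshift_lt.
have [E|ne] := eqVneq (cshift l a g) b.
  by move/eqP: E; rewrite -dE eq_cshift // (negbTE gd).
by case: (fst_ _ _ uk gl' eg ne) => _ /eqP; rewrite -[X in _ == X]a0E eq_cshift // (negbTE g0).
Qed.

(* If p starts at a vertex attached to h_0 and h_(l-1) and is attached to even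
   indices only, parity leaves three possibilities for its attachments since the
   last relevant visit to this edge. *)
Definition far_state h i := exists r a,
  [/\ r <= i, e (p r) (h 0) /\ e (p r) (h l.-1), 0 < a /\ a < l.-1, ~~ odd a &
    forall t g, r < t -> t <= i -> g < l -> e (p t) (h g) -> g = a].

(** Here [u] and [w] are the two ends of the edge: the path has gone from [u] to [w] and has seen
    nothing else since. *)
Definition near_state u w h i := exists r,
  [/\ r <= i, e (p r) (h u),
    forall t g, r < t -> t <= i -> g < l -> e (p t) (h g) -> g = w &
    exists s, [/\ r < s, s <= i & e (p s) (h w)]].

Definition state h i :=
  [\/ far_state h i, near_state l.-1 0 h i | near_state 0 l.-1 h i].

Definition attached (h : nat -> 'I_n) t := [exists g : 'I_l, e (p t) (h g)].

Lemma attachedP h t : reflect (exists2 g, g < l & e (p t) (h g)) (attached h t).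
Proof.
apply: (iffP existsP) => [[g eg]|[g gl eg]]; first by exists g.
by exists (Ordinal gl).
Qed.

Lemma unattached h t g : ~~ attached h t -> g < l -> ~~ e (p t) (h g).
Proof. by move=> na gl; apply: contra na => eg; apply/attachedP; exists g. Qed.

Lemma state0 h : rim h -> e (p 0) (h 0) -> e (p 0) (h l.-1) -> state h 0.
Proof.
move=> Hh p0 p1; have lodd := rim_odd e_sym e_irr ehf Hh; have [[l4 _] _] := Hh.
(* The value [2] is a placeholder: nothing has been attached after index [0] yet. *)
by constructor 1; exists 0, 2; split=> //; lia.
Qed.

(** The attachments of the new vertex form a clique of even positions, and [0] and [l - 1] are the
    only adjacent even positions. So it sees nothing, both of these, or a single [g], which
    [no_jump] compares with the latest earlier attachment. *)
Lemma state_step h i : rim h -> i.+1 < k ->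
  (forall g, g < l -> e (p i.+1) (h g) -> ~~ odd g) ->
  state h i -> state h i.+1.
Proof.
move=> Hh ik evn; have lodd := rim_odd e_sym e_irr ehf Hh; have [[l4 _] _] := Hh.
have S1 t : t <= i.+1 -> t <= i \/ t = i.+1 by lia.
have [|nat_] := boolP (attached h i.+1); last first.
  have na g : g < l -> e (p i.+1) (h g) -> False.
    by move=> gl; apply/negP/unattached.
  case=> [[r [a [ri r01 a0l aodd ra]]]|[r [ri r1 rw [s [rs si es]]]]
    |[r [ri r1 rw [s [rs si es]]]]].
  - constructor 1; exists r, a; split=> //; first by lia.
    by move=> t g rt /S1[ti|->] gl; [apply: ra|move/na; case].
  - constructor 2; exists r; split=> //; first by lia.
      by move=> t g rt /S1[ti|->] gl; [apply: rw|move/na; case].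
    by exists s; split=> //; lia.
  - constructor 3; exists r; split=> //; first by lia.
      by move=> t g rt /S1[ti|->] gl; [apply: rw|move/na; case].
    by exists s; split=> //; lia.
have [/andP[e0 e1] _ _|ne] := boolP (e (p i.+1) (h 0) && e (p i.+1) (h l.-1)).
  by constructor 1; exists i.+1, 2; split=> //; lia.
case/attachedP => g gl eg.
have only g' : g' < l -> e (p i.+1) (h g') -> g' = g.
  move=> gl' eg'; apply/eqP; apply: contraNT ne => gg.
  have := path_clique Hh ik gl' gl eg' eg gg; move: (evn _ gl eg) (evn _ gl' eg').
  rewrite /cadj => o1 o2 /or4P[|||]; try lia.
    by case/andP => /eqP g0 /eqP g1; rewrite -g0 -g1 eg eg'.
  by case/andP => /eqP g0 /eqP g1; rewrite -g0 -g1 eg eg'.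
have gev := evn _ gl eg.
(* Unless the path returns to [u], it stays at [w]: any other [g] would be a forbidden jump. *)
have near u w : u = l.-1 /\ w = 0 \/ u = 0 /\ w = l.-1 -> g != u ->
    near_state u w h i -> near_state u w h i.+1 \/ far_state h i.+1.
  move=> uw gu [r [ri r1 rw [s [rs si es]]]].
  have [gw|gw] := eqVneq g w.
    left; exists r; split=> //; first by lia.
      move=> t g' rt /S1[ti|->] gl'; first exact: rw.
      by move/(only _ gl'); rewrite gw.
    by exists s; split=> //; lia.
  exfalso; have [na|[s' [rs' si' /attachedP[g' gl' eg'] na]]] := last_before (attached h) r i.
    by move/unattached: (na _ rs si) => /(_ w); rewrite es; lia.
  have g'w : g' = w by apply: rw eg'.
  rewrite g'w in gl' eg'.
  apply: (@no_jump h s' i.+1 w g Hh _ ik gl' gl _ _ eg' eg _ only) => //.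
  - by rewrite eq_sym.
  - by clear -uw gw gu gev lodd gl l4; rewrite /cadj; lia.
  - by move=> g2 gl2 e2; apply: rw e2.
  - by move=> t g2 st ti gl2; apply: unattached => //; apply: na.
case=> [[r [a [ri [r0 r1] [a0 al] aodd ra]]]|St|St].
- have [na|[s' [rs' si' /attachedP[g' gl' eg'] na]]] := last_before (attached h) r i.
    have nat t g' : r < t -> t <= i -> g' < l -> e (p t) (h g') -> False.
      by move=> rt ti gl' eg'; move: (unattached (na _ rt ti) gl'); rewrite eg'.
    have [g0|g0] := eqVneq g 0.
      constructor 2; exists r; split=> //; first by lia.
        move=> t g' rt /S1[ti|->] gl'; first by move/(nat _ _ rt ti gl').
        by move/(only _ gl'); rewrite g0.
      by exists i.+1; split; rewrite -?g0 //; lia.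
    have [g1|g1] := eqVneq g l.-1.
      constructor 3; exists r; split=> //; first by lia.
        move=> t g' rt /S1[ti|->] gl'; first by move/(nat _ _ rt ti gl').
        by move/(only _ gl'); rewrite g1.
      by exists i.+1; split; rewrite -?g1 //; lia.
    constructor 1; exists r, g; split=> //; try lia.
    move=> t g' rt /S1[ti|->] gl'; first by move/(nat _ _ rt ti gl').
    by move/(only _ gl').
  have g'a : g' = a by apply: ra eg'.
  have [ga|ga] := eqVneq g a.
    constructor 1; exists r, a; split=> //; first by lia.
    move=> t g2 rt /S1[ti|->] gl2; first exact: ra.
    by move/(only _ gl2); rewrite ga.
  rewrite g'a in gl' eg'; exfalso.
  apply: (@no_jump h s' i.+1 a g Hh _ ik gl' gl _ _ eg' eg _ only) => //.
  + by rewrite eq_sym.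
  + by clear -ga gev lodd gl l4 a0 al aodd; rewrite /cadj; lia.
  + by move=> g2 gl2 e2; apply: ra e2.
  + by move=> t g2 st ti gl2; apply: unattached => //; apply: na.
- have [g1|g1] := eqVneq g l.-1; last first.
    by case: (near l.-1 0 _ g1 St); [left|constructor 2|constructor 1].
  have [r [ri r1 rw [s [rs si es]]]] := St.
  have [na|[s' [rs' si' /attachedP[g' gl' eg'] na]]] := last_before (attached h) r i.
    by move/unattached: (na _ rs si) => /(_ 0); rewrite es; lia.
  (* The ends of the edge exchange their roles, with the latest visit [s'] to the old end as new
     starting point. *)
  constructor 3; exists s'; split; first by lia.
  + by rewrite -(rw s' g').
  + move=> t g2 st /S1[ti|->] gl2; last by move/(only _ gl2); rewrite g1.
    by move=> e2; move: (unattached (na _ st ti) gl2); rewrite e2.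
  + by exists i.+1; rewrite -?g1; split=> //; lia.
- have [g1|g1] := eqVneq g 0; last first.
    by case: (near 0 l.-1 _ g1 St); [right|constructor 3|constructor 1].
  have [r [ri r1 rw [s [rs si es]]]] := St.
  have [na|[s' [rs' si' /attachedP[g' gl' eg'] na]]] := last_before (attached h) r i.
    by move/unattached: (na _ rs si) => /(_ l.-1); rewrite es; lia.
  constructor 2; exists s'; split; first by lia.
  + by rewrite -(rw s' g').
  + move=> t g2 st /S1[ti|->] gl2; last by move/(only _ gl2); rewrite g1.
    by move=> e2; move: (unattached (na _ st ti) gl2); rewrite e2.
  + by exists i.+1; rewrite -?g1; split=> //; lia.
Qed.

(** The bound [k.-1] exempts the last vertex, the one that will see an odd position. *)
Definition evenly_attached h := forall t g, t < k.-1 -> g < l -> e (p t) (h g) -> ~~ odd g.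

Lemma evenly_rev h : rim h -> evenly_attached h -> evenly_attached (fun g => h (l.-1 - g)).
Proof.
move=> Hh evn t g tk gl /(evn _ _ tk); have := rim_odd e_sym e_irr ehf Hh.
by have [[l4 _] _] := Hh; clear -l4 gl; lia.
Qed.

(** The arc from [j] to [l - 1] is odd and free of attachments inside. The nonadjacent pair is
    [l - 1], [j] if [j = 1], and [0], [j] otherwise, as [j] may then be adjacent to [l - 1]. *)
Lemma final_edge h r j : rim h -> r < k.-1 -> evenly_attached h ->
  e (p r) (h 0) -> e (p r) (h l.-1) ->
  odd j -> j < l -> e (p k.-1) (h j) -> ~~ e (p k.-1) (h j.+1) ->
  (forall t g, r < t -> t < k.-1 -> g < l -> e (p t) (h g) -> 0 < g /\ g < j) -> False.
Proof.
move=> Hh rk evn r0 r1 jodd jl ej nej mid.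
have lodd := rim_odd e_sym e_irr ehf Hh; have [[l4 _] _] := Hh.
have [k0 _ _] := pp; have yk : k.-1 < k by rewrite prednK.
have l0 : 0 < l by clear -l4; lia.
have l1l : l.-1 < l by rewrite prednK.
have cly g : g < l -> e (p k.-1) (h g) -> g = j \/ g.+1 = j \/ j = 1 /\ g = 0.
  move=> gl eg; have [->|ne] := eqVneq g j; first by left.
  have := path_clique Hh yk gl jl eg ej ne; have : g <> j.+1.
    by move=> E; rewrite -E eg in nej.
  by clear -lodd jodd l4 gl jl; rewrite /cadj; lia.
have jlast : at_last e p h r k.-1 j.
  by split=> // t rt ty; apply: contraL jodd; apply: evn.
have lfirst : at_first e p h r k.-1 l.-1.
  split=> // t rt; rewrite leq_eqVlt => /predU1P[->|ty]; apply/negP.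
    by move=> /(cly _ l1l); clear -lodd jodd l4 jl; lia.
  by move=> /(mid _ _ rt ty l1l); clear -jl; lia.
have clean t i : r <= t -> t <= k.-1 -> j < i -> i < l.-1 -> ~~ e (p t) (h i).
  move=> rt ty ji il; have il' : i < l by clear -il; lia.
  apply/negP => ei; move: ty; rewrite leq_eqVlt => /predU1P[tE|ty].
    by rewrite tE in ei; move: (cly _ il' ei); clear -ji; lia.
  move: rt; rewrite leq_eqVlt => /predU1P[rE|rt]; last first.
    by move: (mid _ _ rt ty il' ei); clear -ji; lia.
  rewrite -rE in ei; have := evn _ _ rk il' ei.
  have : adjl i 0 by apply: (path_clique Hh _ il' l0 ei r0); clear -ji rk; lia.
  by rewrite /cadj; clear -ji il lodd jodd; lia.
have jl1 : j < l.-1 by clear -jodd lodd jl; lia.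
have oddlj : odd (l.-1 - j) by clear -jodd lodd jl; lia.
have ry := ltnW rk.
have ends : at_first e p h r k.-1 j /\ at_last e p h r k.-1 l.-1 \/
  at_last e p h r k.-1 j /\ at_first e p h r k.-1 l.-1 by right.
have [j1|j1] := eqVneq j 1.
  apply: (two_arcs_seg e_sym e_irr ehf xC Hh pp ry yk l1l jl _ _ lfirst jlast jl1 l1l oddlj clean ends).
    by clear -l4 j1; lia.
  by clear -l4 j1 lodd; rewrite /cadj; lia.
have first0 : at_first e p h r k.-1 0.
  split=> // t rt; rewrite leq_eqVlt => /predU1P[->|ty]; apply/negP.
    by move=> /(cly _ l0); clear -jodd j1; lia.
  by move=> /(mid _ _ rt ty l0); case.
apply: (two_arcs_seg e_sym e_irr ehf xC Hh pp ry yk l0 jl _ _ first0 jlast jl1 l1l oddlj clean ends).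
  by clear -jodd; lia.
by clear -l4 j1 jl1; rewrite /cadj; lia.
Qed.

(** Here the odd arc runs from [a] to [j], and the nonadjacent pair is [a], [j + 1]. *)
Lemma final_skip h s a j : rim h -> s < k.-1 -> evenly_attached h ->
  ~~ odd a -> 0 < a -> a < j -> e (p s) (h a) ->
  (forall g, g < l -> e (p s) (h g) -> g = a) ->
  (forall t g, s < t -> t < k.-1 -> g < l -> ~~ e (p t) (h g)) ->
  odd j -> j < l -> e (p k.-1) (h j) -> e (p k.-1) (h j.+1) -> False.
Proof.
move=> Hh sk evn aodd a0 aj ea oa mid jodd jl ej ej1.
have lodd := rim_odd e_sym e_irr ehf Hh; have [[l4 _] _] := Hh.
have [k0 _ _] := pp; have yk : k.-1 < k by rewrite prednK.
have al : a < l by apply: ltn_trans aj jl.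
have jl1 : j.+1 < l by clear -jodd lodd jl; lia.
have cly g : g < l -> e (p k.-1) (h g) -> j <= g \/ g = 0.
  move=> gl eg; have [->|ne] := eqVneq g j.+1; first by left.
  have := path_clique Hh yk gl jl1 eg ej1 ne.
  by clear -l4 gl jl1; rewrite /cadj; lia.
have last_at g : g < l -> g != a -> e (p k.-1) (h g) -> at_last e p h s k.-1 g.
  move=> gl ga eg; split=> // t; rewrite leq_eqVlt => /predU1P[<-|st] ty; last exact: mid.
  by apply: contraNN ga => /(oa _ gl)->.
have firsta : at_first e p h s k.-1 a.
  split=> // t st; rewrite leq_eqVlt => /predU1P[->|ty]; last exact: mid.
  by apply/negP => /(cly _ al); clear -aj a0; lia.
have jlast : at_last e p h s k.-1 j by apply: last_at => //; clear -aj; lia.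
have j1last : at_last e p h s k.-1 j.+1 by apply: last_at => //; clear -aj; lia.
apply: (two_arcs_seg e_sym e_irr ehf xC Hh pp (ltnW sk) yk al jl1 _ _ firsta j1last aj jl) => //.
- by clear -aj; lia.
- by clear -aj a0 jl1; rewrite /cadj; lia.
- by clear -aj jodd aodd; lia.
- move=> t i st ty ai ij; have il : i < l by apply: ltn_trans ij jl.
  apply/negP => ei; move: ty; rewrite leq_eqVlt => /predU1P[tE|ty].
    by rewrite tE in ei; move: (cly _ il ei); clear -ij ai; lia.
  move: st; rewrite leq_eqVlt => /predU1P[sE|st].
    by rewrite -sE in ei; move: (oa _ il ei); clear -ai; lia.
  by move: (mid _ _ st ty il); rewrite ei.
- by left.
Qed.

Lemma final_far_above h r s a j : rim h -> r < s -> s < k.-1 -> evenly_attached h ->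
  e (p r) (h 0) -> e (p r) (h l.-1) -> ~~ odd a -> 0 < a -> e (p s) (h a) ->
  (forall t g, r < t -> t < k.-1 -> g < l -> e (p t) (h g) -> g = a) ->
  (forall t g, s < t -> t < k.-1 -> g < l -> ~~ e (p t) (h g)) ->
  odd j -> a < j -> j < l -> e (p k.-1) (h j) -> False.
Proof.
move=> Hh rs sk evn r0 r1 aodd a0 ea ra mid jodd aj jl ej.
have [ej1|nej1] := boolP (e (p k.-1) (h j.+1)).
  by apply: (final_skip Hh sk evn aodd a0 aj ea) ej1 => // g gl; apply: ra.
apply: (final_edge Hh (ltn_trans rs sk) evn r0 r1 jodd jl ej nej1).
by move=> t g rt tk gl /(ra _ _ rt tk gl)->.
Qed.

Lemma rev_idx h g : g <= l.-1 -> h (l.-1 - (l.-1 - g)) = h g :> 'I_n.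
Proof. by move=> gl; rewrite subKn. Qed.

(** The last vertex cannot see both [j - 1] and [j + 1], and an earlier attachment [a] lies on one
    side of [j]; reversing the rim exchanges the two sides. *)
Lemma final_far h j : rim h -> evenly_attached h -> 1 < k -> far_state h k.-2 ->
  odd j -> j < l -> e (p k.-1) (h j) -> False.
Proof.
move=> Hh evn k1 [r [a [ri [r0 r1] [a0 al] aodd ra]]] jodd jl ej.
have lodd := rim_odd e_sym e_irr ehf Hh; have [[l4 _] _] := Hh.
have kE t : (t <= k.-2) = (t < k.-1) by clear -k1; lia.
rewrite kE in ri.
have jl1 : j.+1 < l by clear -jodd lodd jl; lia.
have Hr := rim_rev e_sym Hh; have evr := evenly_rev Hh evn.
have jrl : l.-1 - j < l by clear -jl; lia.
have jrodd : odd (l.-1 - j) by clear -jl jodd lodd; lia.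
have ejr : e (p k.-1) (h (l.-1 - (l.-1 - j))) by rewrite rev_idx //; clear -jl; lia.
have r0' : e (p r) (h (l.-1 - 0)) by rewrite subn0.
have r1' : e (p r) (h (l.-1 - l.-1)) by rewrite subnn.
have [na|[s [rs si /attachedP[g gl eg] na]]] := last_before (attached h) r k.-2.
  have nat t g : r < t -> t < k.-1 -> g < l -> e (p t) (h g) -> False.
    by rewrite -kE => rt ti gl eg; move: (unattached (na _ rt ti) gl); rewrite eg.
  have [ej1|nej1] := boolP (e (p k.-1) (h j.+1)); last first.
    apply: (final_edge Hh ri evn r0 r1 jodd jl ej nej1) => t g rt tk gl eg.
    by case: (nat t g).
  apply: (final_edge Hr ri evr r0' r1' jrodd jrl ejr).
    apply/negP => e1; have yk : k.-1 < k by clear -k1; lia.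
    have il : l.-1 - (l.-1 - j).+1 < l by clear -l4; lia.
    have := path_clique Hh yk il jl1 e1 ej1.
    by clear -jodd lodd jl l4; rewrite /cadj; lia.
  move=> t g rt tk gl eg; case: (nat t (l.-1 - g)) => //.
  by clear -l4; lia.
have ga : g = a by apply: ra eg.
rewrite ga in gl eg; rewrite kE in si.
have ra' t g' : r < t -> t < k.-1 -> g' < l -> e (p t) (h g') -> g' = a.
  by rewrite -kE; apply: ra.
have mid t g' : s < t -> t < k.-1 -> g' < l -> ~~ e (p t) (h g').
  by rewrite -kE => st tk; apply: unattached; apply: na.
case: (ltngtP a j) => [aj|ja|E]; last by rewrite E jodd in aodd.
  exact: (final_far_above Hh rs si evn r0 r1 aodd a0 eg ra' mid jodd aj jl ej).
apply: (@final_far_above _ r s (l.-1 - a) _ Hr rs si evr r0' r1' _ _ _ _ _ jrodd _ jrl ejr).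
- by clear -aodd lodd al; lia.
- by clear -al; lia.
- by rewrite rev_idx // ltnW.
- move=> t g' rt tk gl' /(ra' _ _ rt tk) E; clear -E gl' l4; lia.
- by move=> t g' st tk gl'; apply: mid => //; clear -l4; lia.
- by clear -ja al; lia.
Qed.

(** The odd arc runs from [j] to [l - 1], with a segment starting at [r], if [j = 1] and [2] is not
    seen, or if [j] is not [1] and [j - 1] is seen. Otherwise it runs from [0] to [j], and the
    segment starts at the latest visit to [0]. *)
Lemma final_near h j : rim h -> evenly_attached h -> 1 < k -> near_state l.-1 0 h k.-2 ->
  odd j -> j < l -> e (p k.-1) (h j) -> False.
Proof.
move=> Hh evn k1 [r [ri r1 rw [s0 [rs0 s0i es0]]]] jodd jl ej.
have lodd := rim_odd e_sym e_irr ehf Hh; have [[l4 _] _] := Hh.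
have kE t : (t <= k.-2) = (t < k.-1) by clear -k1; lia.
rewrite kE in ri; have yk : k.-1 < k by clear -k1; lia.
have jl1 : j.+1 < l by clear -jodd lodd jl; lia.
have jl1' : j < l.-1 by clear -jl1; lia.
have l0 : 0 < l by clear -l4; lia.
have l1l : l.-1 < l by rewrite prednK.
have cly g g' : g < l -> g' < l -> e (p k.-1) (h g) -> e (p k.-1) (h g') -> g != g' -> adjl g g'.
  by move=> gl gl' eg eg'; apply: (path_clique Hh yk).
have rw' t g : r < t -> t < k.-1 -> g < l -> e (p t) (h g) -> g = 0.
  by rewrite -kE; apply: rw.
have oddlj : odd (l.-1 - j) by clear -jodd lodd jl; lia.
(* [v] is an attachment of the last vertex not adjacent to [0]: [j] itself, or [2] if [j = 1]. *)
have [/existsP[v /andP[vj ev]]|] := boolP [exists v : 'I_l,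
  ((v == j :> nat) && (j != 1) || (v == 2 :> nat) && (j == 1)) && e (p k.-1) (h v)]; last first.
  rewrite negb_exists => /forallP nv.
  have nv' v : v < l -> (v == j) && (j != 1) || (v == 2) && (j == 1) -> ~~ e (p k.-1) (h v).
    by move=> vl H; have := nv (Ordinal vl); rewrite /= H.
  have j1 : j = 1.
    by apply/eqP; apply: contraLR ej => j1; apply: nv'; rewrite // eqxx j1.
  have n2 : ~~ e (p k.-1) (h 2) by apply: nv'; rewrite ?j1 //; clear -l4; lia.
  have jlast : at_last e p h r k.-1 j.
    by split=> // t rt ty; apply: contraL jodd; apply: evn.
  have cl1 g : g < l -> e (p k.-1) (h g) -> g <= 1.
    move=> gl eg; have [->|ne] := eqVneq g j; first by rewrite j1.
    have := cly _ _ gl jl eg ej ne; have : g <> 2 by move=> E; rewrite -E eg in n2.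
    by clear -lodd j1 l4 gl; rewrite /cadj; lia.
  have lfirst : at_first e p h r k.-1 l.-1.
    split=> // t rt; rewrite leq_eqVlt => /predU1P[->|ty]; apply/negP.
      by move=> /(cl1 _ l1l); clear -l4; lia.
    by move=> /(rw' _ _ rt ty l1l); clear -l4; lia.
  apply: (two_arcs_seg e_sym e_irr ehf xC Hh pp (ltnW ri) yk l1l jl _ _ lfirst jlast jl1' l1l oddlj) => //.
  - by clear -l4 j1; lia.
  - by clear -l4 j1 lodd; rewrite /cadj; lia.
  - move=> t i rt ty ji il; have il' : i < l by clear -il; lia.
    apply/negP => ei; move: ty; rewrite leq_eqVlt => /predU1P[tE|ty].
      by rewrite tE in ei; move: (cl1 _ il' ei); clear -ji j1; lia.
    move: rt; rewrite leq_eqVlt => /predU1P[rE|rt]; last first.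
      by move: (rw' _ _ rt ty il' ei); clear -ji; lia.
    rewrite -rE in ei; have := evn _ _ ri il' ei.
    have : adjl i l.-1 by apply: (path_clique Hh _ il' l1l ei r1); clear -il ri; lia.
    by rewrite /cadj; clear -ji il lodd jodd; lia.
  - by right.
have vl := ltn_ord v; move: (nat_of_ord v) vl vj ev => {}v vl vj ev.
have v0 : v != 0 by clear -vj jodd; lia.
have nv0 : ~~ adjl 0 v by clear -vj jodd jl1 l4 lodd; rewrite /cadj; lia.
have [s [rs si /attachedP[g gl eg] na]] : exists s, [/\ r < s, s <= k.-2, attached h s &
    forall t, s < t -> t <= k.-2 -> ~~ attached h t].
  have [na|//] := last_before (attached h) r k.-2.
  by move/unattached: (na _ rs0 s0i) => /(_ 0 l0); rewrite es0.
have g0 : g = 0 by apply: rw eg.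
rewrite g0 in eg; rewrite kE in si.
have os g' : g' < l -> e (p s) (h g') -> g' = 0 by apply: rw'.
have mid t g' : s < t -> t < k.-1 -> g' < l -> ~~ e (p t) (h g').
  by rewrite -kE => st tk; apply: unattached; apply: na.
have [ej'|nej'] := boolP (e (p k.-1) (h j.-1) && (j != 1)).
  have {ej'}[ej' j1] := andP ej'.
  have j'l : j.-1 < l by clear -jl; lia.
  have cl1 i : i < l -> e (p k.-1) (h i) -> i <= j.
    move=> il ei; have [->|ne] := eqVneq i j; first by [].
    have := cly _ _ il jl ei ej ne; have [->|ne'] := eqVneq i j.-1; first by clear; lia.
    move=> c1; move: (cly _ _ il j'l ei ej' ne') c1.
    by clear -lodd jodd j1 l4 il jl; rewrite /cadj; lia.
  have jlast : at_last e p h r k.-1 j.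
    by split=> // t rt ty; apply: contraL jodd; apply: evn.
  have j'last : at_last e p h r k.-1 j.-1.
    split=> // t rt ty; apply/negP => et.
    move: rt; rewrite leq_eqVlt => /predU1P[rE|rt]; last first.
      by move: (rw' _ _ rt ty j'l et); clear -j1 jodd; lia.
    rewrite -rE in et.
    have : adjl j.-1 l.-1 by apply: (path_clique Hh _ j'l l1l et r1); clear -ri jl1'; lia.
    by rewrite /cadj; clear -j1 jodd jl1' lodd; lia.
  have lfirst : at_first e p h r k.-1 l.-1.
    split=> // t rt; rewrite leq_eqVlt => /predU1P[->|ty]; apply/negP.
      by move=> /(cl1 _ l1l); clear -jl1'; lia.
    by move=> /(rw' _ _ rt ty l1l); clear -l4; lia.
  apply: (two_arcs_seg e_sym e_irr ehf xC Hh pp (ltnW ri) yk l1l j'l _ _ lfirst j'last jl1' l1l oddlj) => //.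
  - by clear -jl1'; lia.
  - by clear -j1 jodd jl1' lodd; rewrite /cadj; lia.
  - move=> t i rt ty ji il; have il' : i < l by clear -il; lia.
    apply/negP => ei; move: ty; rewrite leq_eqVlt => /predU1P[tE|ty].
      by rewrite tE in ei; move: (cl1 _ il' ei); clear -ji; lia.
    move: rt; rewrite leq_eqVlt => /predU1P[rE|rt]; last first.
      by move: (rw' _ _ rt ty il' ei); clear -ji; lia.
    rewrite -rE in ei; have := evn _ _ ri il' ei.
    have : adjl i l.-1 by apply: (path_clique Hh _ il' l1l ei r1); clear -il ri; lia.
    by rewrite /cadj; clear -ji il lodd jodd; lia.
  - by right.
have cl0 i : i < j -> 0 < i -> ~~ e (p k.-1) (h i).
  move=> ij i0; have il : i < l by apply: ltn_trans ij jl.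
  apply/negP => ei; have := cly _ _ il jl ei ej; rewrite (ltn_eqF ij) => /(_ isT) c1.
  have iE : i = j.-1 by move: c1; rewrite /cadj; clear -ij i0 jl1'; lia.
  by move: nej'; rewrite -iE ei /= negbK => /eqP j1; clear -i0 ij j1; lia.
have last_at i : i < l -> i != 0 -> e (p k.-1) (h i) -> at_last e p h s k.-1 i.
  move=> il i0 ei; split=> // t; rewrite leq_eqVlt => /predU1P[<-|st] ty; last exact: mid.
  by apply: contraNN i0 => /(os _ il)->.
have first0 : at_first e p h s k.-1 0.
  split=> // t st; rewrite leq_eqVlt => /predU1P[->|ty]; last exact: mid.
  by apply/negP => e0; move: nv0; rewrite (cly _ _ l0 vl e0 ev) // eq_sym.
have j0 : 0 < j by clear -jodd; lia.
apply: (two_arcs_seg e_sym e_irr ehf xC Hh pp (ltnW si) yk l0 vl _ nv0 first0 (last_at _ vl v0 ev) j0 jl).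
- by rewrite eq_sym.
- by rewrite subn0.
- move=> t i st ty i0 ij; have il : i < l by apply: ltn_trans ij jl.
  apply/negP => ei; move: ty; rewrite leq_eqVlt => /predU1P[tE|ty].
    by rewrite tE in ei; move: (cl0 _ ij i0); rewrite ei.
  move: st; rewrite leq_eqVlt => /predU1P[sE|st].
    by rewrite -sE in ei; move: (os _ il ei); clear -i0; lia.
  by move: (mid _ _ st ty il); rewrite ei.
- by left; split=> //; apply: last_at => //; clear -jodd; lia.
Qed.

End Path.

(** Take a shortest path of [C] from a vertex seeing [0] and [l - 1] to one seeing an odd position.
    Before its last vertex all attachments are even, so one of the three states holds, and each
    excludes an odd attachment. *)
Lemma rim_not_attached h : rim h ->
  (forall i, i < l -> exists2 c, c \in C & e c (h i)) -> False.
Proof.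
move=> H0 /(exists_edge_attached e_sym e_irr ehf connC xC H0).
case=> {H0}{}h [Hh att [c Cc [c0 c1]]].
have lodd := rim_odd e_sym e_irr ehf Hh; have [[l4 _] _] := Hh.
pose R c c' := e c (h 0) && e c (h l.-1) /\ exists j, [/\ j < l, odd j & e c' (h j)].
have [|c' Cc' c'1] := att 1; first by clear -l4; lia.
have [|k [p [pp [/andP[p0 p1] [j [jl jodd ej]]] pmin]]] :=
    @shortest_path _ e C R c c' connC Cc Cc'.
  by split; [rewrite c0|exists 1; split=> //; clear -l4; lia].
have [k0 _ _] := pp.
have l0 : 0 < l by clear -l4; lia.
have l1l : l.-1 < l by rewrite prednK.
have evn : evenly_attached k p h.
  move=> t g tk gl eg; apply/negP => godd.
  have Rt : R (p 0) (p t) by rewrite /R p0 p1; split=> //; exists g.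
  have [||_ tE] := pmin 0 t _ _ Rt => //; first by clear -tk; lia.
  by rewrite tE ltnn in tk.
(* A single vertex would see [0], [l - 1] and an odd position, which are not pairwise adjacent. *)
have [k1|k1] := ltnP 1 k; last first.
  have kE : k.-1 = 0 by clear -k1; lia.
  rewrite kE in ej; have := path_clique pp Hh k0 jl l0 ej p0.
  have := path_clique pp Hh k0 jl l1l ej p1.
  by rewrite /cadj; clear -l4 lodd jodd jl; lia.
have st i : i < k.-1 -> state p h i.
  elim: i => [|i IH] ik; first exact: state0.
  apply: (state_step pp) => //; first by clear -ik; lia.
    by move=> g gl; apply: evn.
  by apply: IH; clear -ik; lia.
case: (st k.-2 _) => [|S|S|S]; first by clear -k1; lia.
- exact: (final_far pp Hh evn k1 S jodd jl ej).
- exact: (final_near pp Hh evn k1 S jodd jl ej).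
(* The third state is the second one on the reversed rim. *)
have Hr := rim_rev e_sym Hh; have evr := evenly_rev Hh evn.
have [r [ri r1 rw [s [rs si es]]]] := S.
apply: (@final_near k p pp _ (l.-1 - j) Hr evr k1).
- exists r; split=> //; first by rewrite subnn.
    by move=> t g rt ti gl /(rw _ _ rt ti) E; clear -E gl l4; lia.
  by exists s; rewrite subn0.
- by clear -jl jodd lodd; lia.
- by clear -l4; lia.
- by rewrite rev_idx //; clear -jl; lia.
Qed.

End Walk.

(** * Elimination vertices *)

Section Elimination.
Variables (n : nat) (e : rel 'I_n).
Hypotheses (e_sym : ssrbool.symmetric e) (e_irr : irreflexive e).

Definition clique (A : {set 'I_n}) :=
  [forall u in A, forall v in A, (u != v) ==> e u v].

Lemma cliqueP (A : {set 'I_n}) : reflect {in A &, forall u v, u != v -> e u v} (clique A).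
Proof.
apply: (iffP forall_inP) => [H u v uA vA|H u uA].
  by have /forall_inP/(_ v vA)/implyP := H _ uA.
by apply/forall_inP => v vA; apply/implyP/H.
Qed.

Lemma cliqueS (A B : {set 'I_n}) : A \subset B -> clique B -> clique A.
Proof.
move=> /subsetP sAB /cliqueP cB; apply/cliqueP => u v uA vA.
by apply: cB; apply: sAB.
Qed.

Definition closed_nbhd (W : {set 'I_n}) v := [set u in W | (u == v) || e v u].

Definition hole_free (A : {set 'I_n}) : Prop :=
  forall l h, ihole e l h -> (forall i, i < l -> h i \in A) -> False.

Lemma connected_add C s c : connected e C -> c \in C -> e s c -> connected e (s |: C).
Proof.
move=> connC Cc esc.
have sub u v : u \in C -> v \in C ->
  connect (fun u v => [&& e u v, u \in s |: C & v \in s |: C]) u v.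
  move=> Cu Cv; apply: connect_sub (connC _ _ Cu Cv) => x y /and3P[exy Cx Cy].
  by apply: connect1; rewrite exy !inE Cx Cy !orbT.
have sc : connect (fun u v => [&& e u v, u \in s |: C & v \in s |: C]) s c.
  by apply: connect1; rewrite esc !inE eqxx Cc orbT.
have cs : connect (fun u v => [&& e u v, u \in s |: C & v \in s |: C]) c s.
  by apply: connect1; rewrite e_sym esc !inE eqxx Cc orbT.
move=> u v; rewrite !inE => /predU1P[->|Cu] /predU1P[->|Cv].
- exact: connect0.
- exact: connect_trans sc (sub _ _ Cc Cv).
- exact: connect_trans (sub _ _ Cu Cc) cs.
- exact: sub.
Qed.

(* Among the pairs (v, C) with v in W and C connected and anticomplete to v,
   maximize #|C|. Then the vertices of W neither in C nor adjacent to C are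
   complete to the neighbours of C in W. *)
Lemma elimination_vertex (W0 : {set 'I_n}) (Good : {set 'I_n} -> Prop) :
  (forall a b c d, a \in W0 -> b \in W0 -> c \in W0 -> d \in W0 ->
    a != c -> b != d -> e a b -> e b c -> e c d -> e d a ->
    ~~ e a c -> ~~ e b d -> False) ->
  (forall A : {set 'I_n}, clique A -> Good A) ->
  (forall A K : {set 'I_n}, Good A -> clique K ->
    {in A & K, forall a k, a != k -> e a k} -> Good (A :|: K)) ->
  (forall v (C S : {set 'I_n}), v \in W0 -> C \subset W0 -> S \subset W0 ->
    connected e C -> (forall c, c \in C -> c != v /\ ~~ e v c) ->
    (forall s, s \in S -> e v s /\ exists2 c, c \in C & e c s) -> Good S) ->
  forall W : {set 'I_n}, W \subset W0 -> W != set0 -> exists2 v, v \in W & Good (closed_nbhd W v).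
Proof.
move=> noC4 G1 G2 G3 W; have [m leWm] := ubnP #|W|; elim: m W leWm => // m IH W.
rewrite ltnS => leWm sW0 W0'.
have [cW|ncW] := boolP (clique W).
  case/set0Pn: W0' => v vW; exists v => //; apply/G1/(cliqueS _ cW).
  by apply/subsetP => u; rewrite inE => /andP[].
pose Pair v (C : {set 'I_n}) := [/\ v \in W, C \subset W, C != set0, connected e C &
   forall c, c \in C -> c != v /\ ~~ e v c].
have [[v C]] : exists vC : 'I_n * {set 'I_n}, Pair vC.1 vC.2 /\
   forall v' C', Pair v' C' -> #|C'| <= #|vC.2|.
  (* Minimizing [n - #|C|] maximizes the size of [C]. *)
  have [m' [[v [C [PvC Em]]] mmin]] : exists m', (exists v C, Pair v C /\ n - #|C| = m') /\
      forall m2, (exists v C, Pair v C /\ n - #|C| = m2) -> m' <= m2.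
    apply: ex_least.
    move: ncW; rewrite negb_forall_in => /exists_inP[u uW].
    rewrite negb_forall_in => /exists_inP[v vW].
    rewrite negb_imply => /andP[uv nuv].
    exists (n - #|[set u]|), v, [set u]; split=> //; split=> //.
    - by rewrite sub1set.
    - by apply/set0Pn; exists u; rewrite inE.
    - by move=> x y /set1P-> /set1P->; apply: connect0.
    - by move=> c /set1P->; rewrite uv e_sym.
  exists (v, C); split=> // v' C' P'.
  have := mmin _ (ex_intro _ v' (ex_intro _ C' (conj P' erefl))).
  have cb (A : {set 'I_n}) : #|A| <= n by rewrite -[X in _ <= X]card_ord max_card.
  by rewrite -Em; move: (cb C) (cb C') => /=; clear; lia.
rewrite /= => -[[vW CW C0 connC vC] Cmax].
pose S := [set s in W | (s \notin C) && [exists c in C, e c s]].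
pose R := W :\: (C :|: S).
(* If [y] missed [s], the pair of [y] and [C] with [s] added would be larger. *)
have grow y s : y \in W -> y \notin C -> (forall c, c \in C -> ~~ e y c) ->
    s \in S -> y != s -> e y s.
  move=> yW yC ynC; rewrite inE => /and3P[sW sC /exists_inP[c Cc ecs]] ys.
  apply: contraT => nys; have : #|s |: C| <= #|C|.
    apply: (Cmax y); split=> //.
    - by rewrite subUset sub1set sW.
    - by apply/set0Pn; exists s; rewrite !inE eqxx.
    - by apply: connected_add connC Cc _; rewrite e_sym.
    - move=> c'; rewrite !inE => /predU1P[->|Cc']; first by rewrite eq_sym.
      by split; [apply: contraNneq yC => <-|apply: ynC].
  by rewrite cardsU1 sC ltnn.
have RP y : y \in R -> [/\ y \in W, y \notin C & forall c, c \in C -> ~~ e y c].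
  rewrite !inE negb_or => /andP[/andP[yC nS] yW]; split=> // c Cc.
  move: nS; rewrite yW yC /= negb_exists_in => /forall_inP/(_ _ Cc).
  by rewrite e_sym.
have RS y s : y \in R -> s \in S -> e y s.
  move=> yR sS; have [yW yC ynC] := RP _ yR; apply: grow => //.
  by apply: contraTneq yR => ->; rewrite in_setD in_setU sS orbT.
have vR : v \in R.
  have vnC : v \notin C by apply/negP => /vC[]; rewrite eqxx.
  rewrite !inE vW (negbTE vnC) /= andbT; apply/negP => /exists_inP[c Cc].
  by rewrite e_sym; apply/negP; case: (vC _ Cc).
have SW : S \subset W by apply/subsetP => s /setIdP[].
have GS : Good S.
  apply: (G3 v C S) => //; [exact: (subsetP sW0)|exact: subset_trans CW sW0|exact: subset_trans SW sW0|].
  move=> s sS; split; first exact: RS.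
  by move: sS; rewrite inE => /and3P[_ _ /exists_inP[c Cc]]; exists c.
have nbhdE y : y \in R -> closed_nbhd W y = closed_nbhd R y :|: S.
  move=> yR; have [yW yC ynC] := RP _ yR.
  apply/setP => u; rewrite !inE.
  have [uW|//] := boolP (u \in W); rewrite ?andbF //=.
  have [uC|uC] /= := boolP (u \in C).
    rewrite (negbTE (ynC _ uC)) orbF; apply/negbTE; apply: contraNneq yC => <- //.
  have [uS|uS] := boolP [exists c in C, e c u]; last by rewrite orbF.
  by rewrite orbT RS ?orbT // inE uW uC.
(* If [R] is a clique, [v] works: its neighbourhood is [S] together with a clique complete to
   [S]. *)
have [cR|ncR] := boolP (clique R).
  exists v => //; rewrite nbhdE // setUC; apply: G2 => //.
    by apply: cliqueS cR; apply/subsetP => u /setIdP[].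
  by move=> s r sS /setIdP[rR _] _; rewrite e_sym RS.
(* Two nonadjacent vertices of [R] and two of [S] would form a 4-cycle. As [S] is a clique complete
   to [R], a vertex found by induction in [R] stays good when [S] is added. *)
have cS : clique S.
  apply/cliqueP => s s' sS s'S ss'; apply: contraT => nss'.
  move: ncR; rewrite negb_forall_in => /exists_inP[r rR].
  rewrite negb_forall_in => /exists_inP[r' r'R].
  rewrite negb_imply => /andP[rr' nrr'].
  have inW0 := subsetP sW0; exfalso.
  have [rW _ _] := RP _ rR; have [r'W _ _] := RP _ r'R.
  have sW := subsetP SW.
  by apply: (noC4 r s r' s' (inW0 _ rW) (inW0 _ (sW _ sS)) (inW0 _ r'W) (inW0 _ (sW _ s'S))
    rr' ss' (RS _ _ rR sS) _ (RS _ _ r'R s'S) _ nrr' nss'); rewrite e_sym RS.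
have [|||y yR Gy] := IH R; last 1 first.
- have [yW _ _] := RP _ yR; exists y => //; rewrite nbhdE //; apply: G2 => //.
  by move=> r s /setIdP[rR _] sS _; apply: RS.
- apply: leq_trans leWm; apply: proper_card; rewrite properE subsetDl /=.
  case/set0Pn: C0 => c Cc; apply/subsetPn; exists c; first exact: (subsetP CW).
  by rewrite !inE Cc.
- by apply: subset_trans sW0; apply: subsetDl.
- by apply/set0Pn; exists v.
Qed.

Lemma ihole_nonadj l h i : ihole e l h -> i < l ->
  exists2 j, j < l & h i != h j /\ ~~ e (h i) (h j).
Proof.
move=> Hh il; have [l4 H] := Hh; have [l1 l2] : 1 < l /\ 2 < l by lia.
exists (cshift l i 2); first exact: cshift_lt.
rewrite (ihole_neq Hh) ?cshift_lt //; rewrite /cshift; case: (ltnP (i + 2) l) => i2.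
  by case: (H i (i + 2)) => [||_ ->]; lia.
by rewrite e_sym; case: (H (i + 2 - l) i) => [||_ ->]; lia.
Qed.

Lemma hole_free_clique A : clique A -> hole_free A.
Proof.
move=> /cliqueP cA l h Hh hA; have l0 : 0 < l by case: Hh => l4 _; lia.
have [j jl [hj nej]] := ihole_nonadj Hh l0.
by move: nej; rewrite cA //; apply: hA.
Qed.

(** Every vertex of a hole misses another one, so no hole inside the union meets [K]. *)
Lemma hole_freeU A K : hole_free A -> clique K ->
  {in A & K, forall a k, a != k -> e a k} -> hole_free (A :|: K).
Proof.
move=> fA /cliqueP cK AK l h Hh hAK.
have [[i il iK]|nK] := classic (exists2 i, i < l & h i \in K).
  have [j jl [hj nej]] := ihole_nonadj Hh il.
  have := hAK _ jl; rewrite inE => /orP[jA|jK].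
    by rewrite e_sym AK // eq_sym in nej.
  by rewrite cK in nej.
apply: (fA l h Hh) => i il; have := hAK _ il; rewrite inE => /orP[//|iK].
by case: nK; exists i.
Qed.

(** Two nonadjacent vertices of the attachment set would close up, through [v] and a shortest path
    of [C], to a hole in [W]. *)
Lemma simplicial_vertex (W : {set 'I_n}) : hole_free W -> W != set0 ->
  exists2 v, v \in W & clique (closed_nbhd W v).
Proof.
move=> fW W0; apply: (@elimination_vertex W clique) => //.
- move=> a b c d aW bW cW dW ac bd ab bc cd da nac nbd.
  apply: (fW 4 (nth a [:: a; b; c; d])).
    exact: ihole_C4.
  by do 4?case=> //.
- move=> A K /cliqueP cA /cliqueP cK AK; apply/cliqueP => u v.
  rewrite !inE => /orP[uA|uK] /orP[vA|vK] uv; do ?[exact: cA|exact: cK|exact: AK].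
  by rewrite e_sym; apply: AK; rewrite // eq_sym.
move=> v C S vW CW SW connC vC SP; apply/cliqueP => s s' sS s'S ss'.
apply: contraT => nss'; exfalso.
have [vs [c Cc ecs]] := SP _ sS; have [vs' [c' Cc' ecs']] := SP _ s'S.
have [|k [p [[k0 ip pC] [p0 p1] pmin]]] :=
    @shortest_path _ e C (fun c c' => e c s /\ e c' s') c c' connC Cc Cc'; first by [].
have notC u : e v u -> u \notin C by move=> evu; apply/negP => /vC[_]; rewrite evu.
have neq u w : e u w -> u != w by apply: contraTneq => ->; rewrite e_irr.
have Hh : ihole e (k + 3) (fun i => if i < k then p i else nth v [:: s; v; s'] ((k + 3).-1 - i)).
  have k4 : 4 <= k + 3 by rewrite addn3.
  apply: (@glue _ e e_sym k p 3 (nth v [:: s; v; s']) ip _ k0 isT k4).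
    move=> i j; case: i => [|[|[|i]]]; case: j => [|[|[|j]]] //= _ _.
    - by rewrite e_sym vs eq_sym neq.
    - by rewrite ss' (negbTE nss').
    - by rewrite vs' neq.
  move=> i j ik j3; have [piv vpi] := vC _ (pC _ ik).
  case: j j3 => [|[|[|j]]] //= _.
  - have -> : p i != s by apply: contraNneq (notC _ vs) => <-; apply: pC.
    split=> //; rewrite andbT andbF orbF; apply/idP/eqP => [es|-> //].
    by case: (pmin i k.-1 _ _ (conj es p1)) => //; rewrite -1?ltnS prednK.
  - by rewrite piv e_sym (negbTE vpi) !andbF.
  - have -> : p i != s' by apply: contraNneq (notC _ vs') => <-; apply: pC.
    split=> //; rewrite andbT andbF /=; apply/idP/eqP => [es|-> //].
    by case: (pmin 0 i _ _ (conj p0 es)).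
apply: (fW _ _ Hh) => i ik; case: (ltnP i k) => lik; first exact/(subsetP CW)/pC.
have : (k + 3).-1 - i < 3 by clear -ik lik; lia.
have sW := subsetP SW.
by case: (_ - i) => [|[|[|t]]] //= _; apply: sW.
Qed.

(** The attachment set is complete to [v] and each of its vertices has a neighbour in [C], so a hole
    in it contradicts [rim_not_attached]. *)
Lemma hole_free_vertex (W : {set 'I_n}) : even_hole_free e -> W != set0 ->
  exists2 v, v \in W & hole_free (closed_nbhd W v).
Proof.
move=> ehf W0; apply: (@elimination_vertex W hole_free) => //.
- move=> a b c d aW bW cW dW; exact: no_C4.
- exact: hole_free_clique.
- exact: hole_freeU.
move=> v C S vW CW SW connC vC SP l h Hh hS.
apply: (@rim_not_attached _ e e_sym e_irr ehf v C l connC vC h).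
  by split=> // i il; case: (SP _ (hS _ il)).
by move=> i il; case: (SP _ (hS _ il)).
Qed.

End Elimination.

(** * The Koszul complex *)

Section Monomials.
Local Open Scope ring_scope.
Variables (k : fieldType) (n : nat).
Notation S := {mpoly k[n]}.

Definition mselect (P : pred 'X_{1..n}) (p : S) : S :=
  \sum_(m <- msupp p | P m) p@_m *: 'X_[m].

Lemma mcoeff_mselect P p m : (mselect P p)@_m = if P m then p@_m else 0.
Proof.
rewrite raddf_sum big_mkcond /=.
have [mp|nmp] := boolP (m \in msupp p).
  rewrite (bigD1_seq m) ?msupp_uniq //= big1 ?addr0.
    by rewrite mcoeffZ mcoeffX eqxx mulr1.
  by move=> m' /negbTE ne; rewrite mcoeffZ mcoeffX ne mulr0; case: ifP.
rewrite [p@_m]memN_msupp_eq0 // if_same big1_seq // => m' /= m'p; case: ifP => // _.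
rewrite mcoeffZ mcoeffX; case: eqP => [E|_]; last by rewrite mulr0.
by rewrite -E m'p in nmp.
Qed.

Lemma mselect_supp P p m : (m \in msupp (mselect P p)) = P m && (m \in msupp p).
Proof. by rewrite !mcoeff_msupp mcoeff_mselect; case: (P m); rewrite ?eqxx. Qed.

Lemma mselectC P p : mselect P p + mselect (predC P) p = p.
Proof.
apply/mpolyP => m; rewrite mcoeffD !mcoeff_mselect /=.
by case: (P m); rewrite ?addr0 ?add0r.
Qed.

Lemma mcoeffXM (l : 'I_n) (p : S) m :
  ('X_l * p)@_m = if m l == 0%N then 0 else p@_(m - U_(l)).
Proof.
have [ml|ml] := eqVneq (m l) 0%N; last first.
  have le : (U_(l) <= m)%MM by rewrite lep1mP.
  by rewrite -{1}(submK le) addmC mulrC mcoeffMX.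
apply/eqP; rewrite mcoeff_eq0 mulrC (perm_mem (msuppMX p U_(l))).
by apply/mapP => -[m' _ E]; move: ml; rewrite E mnmDE mnm1E eqxx.
Qed.

Lemma msuppXM (l : 'I_n) (p : S) m : m \in msupp ('X_l * p) ->
  exists2 m', m' \in msupp p & m = (m' + U_(l))%MM.
Proof.
rewrite mcoeff_msupp mcoeffXM; have [_|ml nz] := eqVneq (m l) 0%N; first by rewrite eqxx.
by exists (m - U_(l))%MM; rewrite ?mcoeff_msupp // submK // lep1mP.
Qed.

Lemma mcoeff_euler (l : 'I_n) (p : S) m : ('X_l * p^`M(l))@_m = p@_m *+ m l.
Proof.
rewrite mcoeffXM; have [->|ml] := eqVneq (m l) 0%N; first by rewrite mulr0n.
rewrite mcoeff_deriv submK ?lep1mP // mnmBE mnm1E eqxx subn1 prednK //.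
by rewrite lt0n.
Qed.
End Monomials.

Section Koszul.
Local Open Scope ring_scope.
Variables (k : fieldType) (n : nat).
Notation S := {mpoly k[n]}.
Implicit Types (A : {set 'I_n}).

Definition ksign (l : 'I_n) A : S := (-1) ^+ #|[set a in A | (a < l)%N]|.

Lemma ksign_sqr l A : ksign l A * ksign l A = 1.
Proof. by rewrite /ksign -expr2 sqrr_sign. Qed.

Lemma ksignU1 l l' A : l \notin A ->
  ksign l' (l |: A) = (-1) ^+ (l < l')%N * ksign l' A.
Proof.
move=> lA; rewrite /ksign -exprD; congr (_ ^+ _).
have -> : [set a in l |: A | (a < l')%N] =
    if (l < l')%N then l |: [set a in A | (a < l')%N] else [set a in A | (a < l')%N].
  apply/setP => a; case: ifP => ll'; rewrite !inE; case: eqP => [->|_] //=;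
    by rewrite ll' ?andbF ?andbT.
by case: ifP => _ //; rewrite cardsU1 !inE (negbTE lA).
Qed.

Lemma ksign_swap l l' A : l \notin A -> l' \notin A -> l != l' ->
  ksign l A * ksign l' (l |: A) = - (ksign l' A * ksign l (l' |: A)).
Proof.
move=> lA l'A ll'; rewrite !ksignU1 //.
have : (l < l')%N (+) (l' < l)%N by move: ll'; rewrite -(inj_eq val_inj) /=; case: ltngtP.
case: (l < l')%N; case: (l' < l)%N => //= _;
  by rewrite ?expr1 ?expr0 ?mul1r ?mulN1r ?mulrN ?opprK mulrC.
Qed.

(** The Koszul differential over [S^m]. A chain is stored as the function giving the coefficient of
    each exterior monomial, so the sum runs over the sets obtained from [A] by adding one
    element. *)
Definition bd (m : nat) (f : {set 'I_n} -> 'rV[S]_m) A : 'rV[S]_m :=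
  \sum_(l | l \notin A) (ksign l A * 'X_l) *: f (l |: A).

Section Linearity.
Variable m : nat.
Implicit Types (f g : {set 'I_n} -> 'rV[S]_m).

Lemma eq_bd f g A : f =1 g -> bd f A = bd g A.
Proof. by move=> fg; apply: eq_bigr => l _; rewrite fg. Qed.

Lemma bdD f g A : bd (fun B => f B + g B) A = bd f A + bd g A.
Proof. by rewrite /bd -big_split; apply: eq_bigr => l _; rewrite scalerDr. Qed.

Lemma bdZ p f A : bd (fun B => p *: f B) A = p *: bd f A.
Proof.
by rewrite /bd scaler_sumr; apply: eq_bigr => l _; rewrite !scalerA mulrC.
Qed.

Lemma bdB f g A : bd (fun B => f B - g B) A = bd f A - bd g A.
Proof.
rewrite bdD -scaleN1r -bdZ; congr (_ + _).
by apply: eq_bd => B; rewrite scaleN1r.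
Qed.

Lemma bd_mulmx m' (D : 'M[S]_(m, m')) f A : bd (fun B => f B *m D) A = bd f A *m D.
Proof.
by rewrite /bd mulmx_suml; apply: eq_bigr => l _; rewrite scalemxAl.
Qed.
End Linearity.

Hypothesis char0 : [pchar k] =i pred0.

Lemma natr_neq0 i : (0 < i)%N -> (i%:R : k) != 0.
Proof. by rewrite ((pcharf0P k).1 char0) lt0n. Qed.

Lemma eqN_eq0 m (v : 'rV[S]_m) : v = - v -> v = 0.
Proof.
move=> E; apply/rowP => a; apply/mpolyP => mon.
move/rowP/(_ a)/(congr1 (mcoeff mon)): E; rewrite !mxE mcoeffN mcoeff0.
move/eqP; rewrite -addr_eq0 -mulr2n -mulr_natr mulf_eq0 (negbTE (natr_neq0 _)) //.
by rewrite orbF => /eqP.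
Qed.

(** The double sum is antisymmetric in [l] and [l'] by [ksign_swap], so it equals its own
    opposite. *)
Lemma bd_bd m (f : {set 'I_n} -> 'rV[S]_m) A : bd (bd f) A = 0.
Proof.
pose G l l' := if [&& l \notin A, l' \notin A & l != l'] then
  (ksign l A * ksign l' (l |: A) * ('X_l * 'X_l')) *: f (l' |: (l |: A)) else 0.
have -> : bd (bd f) A = \sum_l \sum_l' G l l'.
  rewrite /bd big_mkcond; apply: eq_bigr => l _; rewrite /G.
  case: ifP => [lA|_] /=; last by rewrite big1.
  rewrite scaler_sumr big_mkcond; apply: eq_bigr => l' _.
  rewrite !inE negb_or [l == l']eq_sym andbC; case: ifP => // _.
  by rewrite scalerA mulrACA.
apply: eqN_eq0; rewrite {1}exchange_big /= -sumrN; apply: eq_bigr => l _.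
rewrite -sumrN; apply: eq_bigr => l' _; rewrite /G eq_sym andbCA.
case: ifP => [/and3P[lA l'A ll']|_]; last by rewrite oppr0.
by rewrite ksign_swap 1?eq_sym // mulNr scaleNr ['X_l * _]mulrC setUCA.
Qed.

(** Homological degree [i] and internal degree [j]; each exterior generator has degree 1, whence the
    summand [i]. *)
Definition chain m (d : 'I_m -> nat) (i j : nat) (f : {set 'I_n} -> 'rV[S]_m) :=
  forall A a mon, mon \in msupp (f A 0 a) -> #|A| = i /\ (mdeg mon + d a + i)%N = j.

(* The homotopy sending f e_A to the exterior product of df with e_A. *)
Definition hty (f : {set 'I_n} -> S) A : S :=
  \sum_(l in A) ksign l (A :\ l) * (f (A :\ l))^`M(l).

Definition bd1 (f : {set 'I_n} -> S) A : S :=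
  \sum_(l | l \notin A) ksign l A * 'X_l * f (l |: A).

Lemma bd_bd1 m (f : {set 'I_n} -> 'rV[S]_m) A a : bd f A 0 a = bd1 (fun B => f B 0 a) A.
Proof. by rewrite summxE; apply: eq_bigr => l _; rewrite mxE. Qed.

Lemma mderiv_ksign l l' A p : (ksign l A * p)^`M(l') = ksign l A * p^`M(l').
Proof.
rewrite /ksign -signr_odd; case: odd; rewrite ?expr0 ?mul1r // expr1 !mulN1r.
exact: mderivN.
Qed.

(** Inserting and removing the same index yields the Euler operator plus the cardinality of [A]; the
    mixed terms cancel by [ksign_swap]. *)
Lemma cartan f A :
  bd1 (hty f) A + hty (bd1 f) A = \sum_l 'X_l * (f A)^`M(l) + f A *+ #|A|.
Proof.
pose X l l' := ksign l A * 'X_l * (ksign l' ((l |: A) :\ l') * (f ((l |: A) :\ l'))^`M(l')).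
have -> : bd1 (hty f) A = \sum_(l | l \notin A) 'X_l * (f A)^`M(l) +
    \sum_(l | l \notin A) \sum_(l' in A) X l l'.
  rewrite -big_split; apply: eq_bigr => l lA; rewrite /hty big_setU1 //=.
  rewrite mulrDr setU1K //; congr (_ + _); last by rewrite mulr_sumr.
  by rewrite mulrCA !mulrA ksign_sqr mul1r.
have -> : hty (bd1 f) A = \sum_(l' in A) ('X_l' * (f A)^`M(l') + f A) +
    \sum_(l' in A) \sum_(l | l \notin A) - X l l'.
  rewrite -big_split; apply: eq_bigr => l' l'A; rewrite /bd1.
  rewrite (bigD1 l') /=; last by rewrite !inE eqxx.
  rewrite setD1K // mderivD mulrDr -mulrA mderiv_ksign mulrA ksign_sqr mul1r.
  rewrite mderivM mderivX mnm1E eqxx scale1r (_ : (U_(l') - U_(l'))%MM = 0%MM); last first.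
    by apply/mnmP => i; rewrite mnm0E mnmBE subnn.
  rewrite mpolyX0 mul1r; congr (_ + _); first by rewrite addrC.
  rewrite raddf_sum mulr_sumr; apply: eq_big => [l|l].
    by rewrite !inE; case: eqP => [->|_]; rewrite ?l'A ?andbF //= andbT.
  rewrite !inE => /andP[/nandP lA ll'].
  have {}lA : l \notin A by case: lA => //; rewrite ll'.
  have l'l : (l == l') = false by apply/negbTE.
  have E : (l |: A) :\ l' = l |: (A :\ l').
    by apply/setP => a; rewrite !inE; case: eqP => [->|] //=; rewrite eq_sym l'l.
  rewrite /X E /= -mulrA mderiv_ksign mderivM mderivX mnm1E l'l scale0r mul0r add0r.
  have := @ksign_swap l l' (A :\ l').
  rewrite !inE eqxx /= (negbTE lA) andbF l'l setD1K // => /(_ isT isT isT) sw.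
  have bb := ksign_sqr l' (l |: A :\ l'); have cc := ksign_sqr l' (A :\ l').
  move: sw bb cc; set a := ksign l _; set b := ksign l' _; set c := ksign l' _.
  set d := ksign l A; set x := 'X_l; set y := _^`M(_) => sw bb cc.
  have -> : c * (a * (x * y)) = (b * b) * (c * (a * (x * y))) by rewrite bb mul1r.
  have -> : b * b * (c * (a * (x * y))) = (a * b) * (b * c * x * y) by ring.
  by rewrite sw -[RHS]mul1r -cc; ring.
have -> : \sum_(l' in A) ('X_l' * (f A)^`M(l') + f A) =
    \sum_(l' in A) 'X_l' * (f A)^`M(l') + f A *+ #|A|.
  by rewrite big_split /= sumr_const.
rewrite [X in _ + (_ + X)]exchange_big /= addrACA.
have -> : \sum_(l | l \notin A) \sum_(l' in A) X l l' +
    \sum_(l | l \notin A) \sum_(l' in A) - X l l' = 0.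
  by rewrite -big_split big1 //= => l _; rewrite sumrN subrr.
rewrite addr0 addrA; congr (_ + _).
by rewrite addrC [RHS](bigID (mem A)).
Qed.

(** On coordinate [a] the right-hand side of [cartan] is multiplication by [j - d a], invertible in
    characteristic 0; dividing the homotopy by it gives a preimage. *)
Lemma bd_exact m (d : 'I_m -> nat) i j (f : {set 'I_n} -> 'rV[S]_m) :
  chain d i j f -> (forall A, bd f A = 0) ->
  (forall A a mon, mon \in msupp (f A 0 a) -> (d a < j)%N) ->
  exists g, chain d i.+1 j g /\ bd g =1 f.
Proof.
move=> cf f0 dj; exists (fun A => \row_a ((j - d a)%N%:R^-1 *: hty (fun B => f B 0 a) A)).
split=> [A a mon|A].
  rewrite mxE => /msuppZ_le; rewrite /hty => /msupp_sum_le/flatten_mapP[l].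
  rewrite mem_filter => /andP[lA _].
  rewrite /ksign -signr_odd => mon_in.
  have {mon_in} : mon \in msupp ((f (A :\ l) 0 a)^`M(l)).
    by move: mon_in; case: odd; rewrite ?expr0 ?mul1r // expr1 mulN1r (perm_mem (msuppN _)).
  rewrite mcoeff_msupp mcoeff_deriv => nz.
  have /cf[cA jE] : (mon + U_(l))%MM \in msupp (f (A :\ l) 0 a).
    by rewrite mcoeff_msupp; apply: contraNneq nz => ->; rewrite mul0rn.
  rewrite (cardsD1 l A) lA cA; split=> //.
  by move: jE; rewrite mdegD mdeg1; lia.
apply/rowP => a; rewrite bd_bd1.
have -> : bd1 (fun B => (\row_a ((j - d a)%N%:R^-1 *: hty (fun B => f B 0 a) B)) 0 a) A =
    (j - d a)%N%:R^-1 *: bd1 (hty (fun B => f B 0 a)) A.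
  by rewrite /bd1 scaler_sumr; apply: eq_bigr => l _; rewrite mxE scalerAr.
have -> : bd1 (hty (fun B => f B 0 a)) A = f A 0 a *+ (j - d a).
  have := cartan (fun B => f B 0 a) A.
  have -> : hty (bd1 (fun B => f B 0 a)) A = 0.
    by rewrite /hty big1 // => l _; rewrite -bd_bd1 f0 mxE mderiv0 mulr0.
  rewrite addr0 => ->; apply/mpolyP => mon.
  rewrite mcoeffD raddf_sum !mcoeffMn /=.
  have [nz|z] := boolP (mon \in msupp (f A 0 a)); last first.
    rewrite (memN_msupp_eq0 z) !mul0rn addr0 big1 // => l _.
    by rewrite mcoeff_euler (memN_msupp_eq0 z) mul0rn.
  have [cA jE] := cf _ _ _ nz.
  rewrite (eq_bigr (fun l => (f A 0 a)@_mon *+ mon l)); last by move=> l _; rewrite mcoeff_euler.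
  by rewrite sumrMnr -mdegE -mulrnDr cA; congr (_ *+ _); lia.
have [->|nz] := eqVneq (f A 0 a) 0; first by rewrite mul0rn scaler0.
have [mon mon_in] : exists mon, mon \in msupp (f A 0 a).
  by have := nz; rewrite -msupp_eq0; case: (msupp _) => // mon s _; exists mon; rewrite inE eqxx.
rewrite -scaler_nat scalerA mulVf ?scale1r //.
by apply: natr_neq0; rewrite subn_gt0; apply: dj mon_in.
Qed.

(** For a graded submodule [Z] of [S^m] this is the vanishing of $Tor_i(k, Z)_j$, computed by the
    Koszul complex. *)
Definition vanish m (d : 'I_m -> nat) (Z : 'rV[S]_m -> Prop) i j : Prop :=
  forall f, chain d i j f -> (forall A, Z (f A)) -> (forall A, bd f A = 0) ->
  exists g, [/\ chain d i.+1 j g, forall A, Z (g A) & bd g =1 f].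

Lemma chainD m (d : 'I_m -> nat) i j f g :
  chain d i j f -> chain d i j g -> chain d i j (fun A => f A + g A).
Proof.
move=> cf cg A a mon; rewrite mxE => /msuppD_le; rewrite mem_cat.
by case/orP; [apply: cf|apply: cg].
Qed.

Lemma chainN m (d : 'I_m -> nat) i j f : chain d i j f -> chain d i j (fun A => - f A).
Proof. by move=> cf A a mon; rewrite mxE (perm_mem (msuppN _)); apply: cf. Qed.

Lemma chain_bd m (d : 'I_m -> nat) i j f : chain d i.+1 j f -> chain d i j (bd f).
Proof.
move=> cf A a mon; rewrite bd_bd1 => /msupp_sum_le/flatten_mapP[l].
rewrite mem_filter => /andP[lA _]; rewrite /ksign -signr_odd -mulrA => mon_in.
have {mon_in} /msuppXM[mon' /cf[cA jE] ->] : mon \in msupp ('X_l * f (l |: A) 0 a).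
  by move: mon_in; case: odd; rewrite ?expr0 ?mul1r // expr1 mulN1r (perm_mem (msuppN _)).
move: cA jE; rewrite cardsU1 lA mdegD mdeg1; lia.
Qed.

Lemma chainX m (d : 'I_m -> nat) i j (l : 'I_n) f :
  chain d i j f -> chain d i j.+1 (fun A => 'X_l *: f A).
Proof.
move=> cf A a mon; rewrite mxE => /msuppXM[mon' /cf[cA jE] ->].
by move: cA jE; rewrite mdegD mdeg1; lia.
Qed.

End Koszul.

(** * Ideals of clique complexes *)

Section Faces.
Local Open Scope ring_scope.
Variables (k : fieldType) (n : nat).
Notation S := {mpoly k[n]}.
Hypothesis char0 : [pchar k] =i pred0.

Definition msupport (mon : 'X_{1..n}) : {set 'I_n} := [set i | mon i != 0%N].

Lemma msupportD m1 m2 : msupport (m1 + m2)%MM = msupport m1 :|: msupport m2.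
Proof. by apply/setP => i; rewrite !inE mnmDE addn_eq0 negb_and. Qed.

Lemma msupportU (l : 'I_n) : msupport U_(l) = [set l].
Proof. by apply/setP => i; rewrite !inE mnm1E [l == i]eq_sym; case: (i == l). Qed.

Lemma msupportDU mon l : msupport (mon + U_(l))%MM = l |: msupport mon.
Proof. by rewrite msupportD msupportU setUC. Qed.

(** Division by $x_v$, meaningful only if every monomial contains $x_v$, because the subtraction is
    truncated. *)
Definition mdivX (v : 'I_n) (p : S) : S :=
  \sum_(mon <- msupp p) p@_mon *: 'X_[mon - U_(v)].

Lemma mdivXK v p : (forall mon, mon \in msupp p -> v \in msupport mon) ->
  'X_v * mdivX v p = p.
Proof.
move=> pv; rewrite /mdivX mulr_sumr [RHS]mpolyE; apply: eq_big_seq => mon mp.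
rewrite -scalerAr -mpolyXD addmC submK // lep1mP.
by have := pv _ mp; rewrite inE.
Qed.

Lemma msuppXM_in (l : 'I_n) (p : S) mon :
  mon \in msupp p -> (mon + U_(l))%MM \in msupp ('X_l * p).
Proof.
by move=> mp; rewrite mulrC (perm_mem (msuppMX _ _)) addmC map_f.
Qed.

Section Complex.
Variable e : rel 'I_n.
Implicit Types W : {set 'I_n}.

Definition face W (mon : 'X_{1..n}) := (msupport mon \subset W) && clique e (msupport mon).

Lemma faceS W W' mon : W \subset W' -> face W mon -> face W' mon.
Proof. by move=> sW /andP[sm cm]; rewrite /face (subset_trans sm). Qed.

Lemma faceD W m1 m2 : face W (m1 + m2)%MM -> face W m2.
Proof.
rewrite /face msupportD subUset => /andP[/andP[_ ->]] /=.
by apply: cliqueS; apply: subsetUr.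
Qed.

(** The cliques of [W] that stay cliques of [W] when [v] is added are those inside the closed
    neighbourhood; this is the source of $J_W : x_v = J_{N[v]}$. *)
Lemma face_link (e_sym : ssrbool.symmetric e) W mon v : v \in W ->
  face W (mon + U_(v))%MM = face (closed_nbhd e W v) mon.
Proof.
move=> vW; rewrite /face msupportDU; apply/andP/andP => -[].
  rewrite subUset => /andP[_ /subsetP sW] /cliqueP cv; split.
    apply/subsetP => u um; rewrite inE sW //=; case: eqVneq => //= uv.
    by apply: cv; [exact: setU11|exact: setU1r|rewrite eq_sym].
  by apply/cliqueP => u u' um u'm; apply: cv; apply: setU1r.
move=> /subsetP sN /cliqueP cm; split.
  by rewrite subUset sub1set vW; apply/subsetP => u /sN; rewrite inE => /andP[].
have vadj u : u \in msupport mon -> u != v -> e v u.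
  by move=> /sN; rewrite inE => /andP[_ /orP[->|]].
apply/cliqueP => u u'; rewrite !in_setU1 => /predU1P[->|um] /predU1P[->|u'm].
- by rewrite eqxx.
- by rewrite eq_sym; apply: vadj.
- by rewrite e_sym; apply: vadj.
- exact: cm.
Qed.

Lemma face_cone W mon v : face W mon -> ~~ face (W :\ v) mon -> v \in msupport mon.
Proof.
move=> /andP[sm cm]; apply: contraR => vm; rewrite /face cm andbT.
by rewrite subsetD1 sm.
Qed.

Lemma faceN W mon v : v \notin W -> ~~ face W (mon + U_(v))%MM.
Proof. by move=> vW; rewrite /face msupportDU subUset sub1set (negbTE vW). Qed.

(* For m = 1 this is the ideal J_W; all these ideals live in the same ring. *)
Definition nonface_mod W m (v : 'rV[S]_m) : Prop :=
  forall a mon, mon \in msupp (v 0 a) -> ~~ face W mon.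

Section Module.
Variable m : nat.
Implicit Types u v : 'rV[S]_m.

Lemma nonface0 W : nonface_mod W (0 : 'rV[S]_m).
Proof. by move=> a mon; rewrite mxE msupp0. Qed.

Lemma nonfaceD W u v : nonface_mod W u -> nonface_mod W v -> nonface_mod W (u + v).
Proof.
move=> Hu Hv a mon; rewrite mxE => /msuppD_le; rewrite mem_cat.
by case/orP; [apply: Hu|apply: Hv].
Qed.

Lemma nonfaceN W u : nonface_mod W u -> nonface_mod W (- u).
Proof. by move=> Hu a mon; rewrite mxE (perm_mem (msuppN _)); apply: Hu. Qed.

Lemma nonfaceS W W' u : W \subset W' -> nonface_mod W' u -> nonface_mod W u.
Proof. by move=> sW Hu a mon /Hu; apply: contra; apply: faceS. Qed.

Lemma nonfaceZ W (p : S) u : nonface_mod W u -> nonface_mod W (p *: u).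
Proof.
move=> Hu a mon; rewrite mxE => /msuppM_le/allpairsP[[m1 m2] /= [m1p m2u ->]].
by apply: contra (Hu _ _ m2u); apply: faceD.
Qed.

Lemma nonface_sum W (I : Type) (r : seq I) (P : pred I) (F : I -> 'rV[S]_m) :
  (forall i, P i -> nonface_mod W (F i)) -> nonface_mod W (\sum_(i <- r | P i) F i).
Proof. by move=> H; apply: big_ind => //; [apply: nonface0|apply: nonfaceD]. Qed.

Lemma nonface_bd W (f : {set 'I_n} -> 'rV[S]_m) :
  (forall A, nonface_mod W (f A)) -> forall A, nonface_mod W (bd f A).
Proof. by move=> Hf A; apply: nonface_sum => l _; apply: nonfaceZ. Qed.

Lemma nonface_colon (e_sym : ssrbool.symmetric e) W (v : 'I_n) u : v \in W ->
  nonface_mod W ('X_v *: u) <-> nonface_mod (closed_nbhd e W v) u.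
Proof.
move=> vW; split=> Hu a mon.
  move=> mon_in; rewrite -face_link //; apply: (Hu a); rewrite mxE.
  exact: msuppXM_in.
by rewrite mxE => /msuppXM[mon' /Hu nf ->]; rewrite face_link.
Qed.

Lemma nonface_out W (v : 'I_n) u : v \notin W -> nonface_mod W ('X_v *: u).
Proof. by move=> vW a mon; rewrite mxE => /msuppXM[mon' _ ->]; apply: faceN. Qed.

(* (J_W, x_v) is the ideal J_{W \ v}. *)
Lemma nonface_split W (v : 'I_n) (d : 'I_m -> nat) i j (f : {set 'I_n} -> 'rV[S]_m) :
  chain d i j f -> (forall A, nonface_mod (W :\ v) (f A)) ->
  exists g h, [/\ chain d i j g, chain d i j.-1 h, forall A, nonface_mod W (g A) &
    forall A, f A = g A + 'X_v *: h A].
Proof.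
move=> cf Hf.
pose r A a := mselect (face W) (f A 0 a).
have rX A a : 'X_v * mdivX v (r A a) = r A a.
  apply: mdivXK => mon; rewrite mselect_supp => /andP[fm mf].
  exact: face_cone fm (Hf _ _ _ mf).
exists (fun A => \row_a mselect (predC (face W)) (f A 0 a)).
exists (fun A => \row_a mdivX v (r A a)); split.
- by move=> A a mon; rewrite mxE mselect_supp => /andP[_ /cf].
- move=> A a mon; rewrite mxE => /(msuppXM_in v); rewrite rX mselect_supp.
  by case/andP => _ /cf[cA jE]; split=> //; move: jE; rewrite mdegD mdeg1; lia.
- by move=> A a mon; rewrite mxE mselect_supp => /andP[].
- by move=> A; apply/rowP => a; rewrite !mxE rX addrC mselectC.
Qed.

End Module.

(** The regularity of $J_W$ is at most [r]; as a vanishing statement this covers the zero ideal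
    too. *)
Definition regle W r := forall i j, (i + r < j)%N ->
  vanish (fun _ : 'I_1 => 0%N) (@nonface_mod W 1) i j.

Lemma regleS W r : regle W r -> regle W r.+1.
Proof. by move=> H i j ij; apply: H; lia. Qed.

Hypothesis e_sym : ssrbool.symmetric e.

(** A cycle [f] of $J_W$ is the boundary of some $u + x_v y$ with $u$ in $J_W$. The boundary of $y$
    lies in $J_{N[v]}$, where it bounds some $g$, and $u + x_v g$ has boundary [f]. *)
Lemma regle_vertex W v r : v \in W -> regle (closed_nbhd e W v) r -> regle (W :\ v) r.+1 ->
  regle W r.+1.
Proof.
move=> vW Hlk Hdel i j ij f cf Jf f0.
have [|w [cw Jw wf]] := Hdel i j ij f cf _ f0.
  by move=> A; apply: nonfaceS (Jf A); apply: subD1set.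
have [u [y [cu cy Ju wE]]] := nonface_split cw Jw.
have bdw A : f A = bd u A + 'X_v *: bd y A.
  by rewrite -bdZ -bdD -wf; apply: eq_bd.
have Jy A : nonface_mod (closed_nbhd e W v) (bd y A).
  apply/(nonface_colon e_sym _ vW); have -> : 'X_v *: bd y A = f A - bd u A.
    by rewrite bdw addrC addKr.
  by apply: nonfaceD (Jf A) _; apply: nonfaceN; apply: nonface_bd.
have [||g [cg Jg gy]] := Hlk i j.-1 _ _ (chain_bd cy) Jy; first by lia.
  exact: bd_bd.
exists (fun A => u A + 'X_v *: g A); split.
- by apply: chainD cu _; rewrite -(@prednK j); [apply: chainX|lia].
- by move=> A; apply: nonfaceD (Ju A) _; apply/(nonface_colon e_sym _ vW).
- by move=> A; rewrite bdD bdZ gy -bdw.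
Qed.

(** As [v] is adjacent to the rest of [W], $J_W : x_v = J_W$. For a cycle $z_1 + x_v z_2$ some $y$
    in $J_W$ has the boundary of $z_2$; then $z_2 - y$ is a boundary in the polynomial ring and $z_1
    + x_v y$ is one in $J_W$. *)
Lemma regle_cone W v : v \in W -> closed_nbhd e W v = W -> regle W 1 -> regle (W :\ v) 1.
Proof.
move=> vW NW H i j ij f cf Jf f0.
have vn : v \notin W :\ v by rewrite !inE eqxx.
have [z1 [z2 [c1 c2 J1 fE]]] := nonface_split cf Jf.
have bdf A : bd z1 A + 'X_v *: bd z2 A = 0.
  by rewrite -bdZ -bdD -[RHS](f0 A); apply: eq_bd => B; rewrite fE.
have J2 A : nonface_mod W (bd z2 A).
  rewrite -{1}NW; apply/(nonface_colon e_sym _ vW).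
  have -> : 'X_v *: bd z2 A = - bd z1 A by apply/eqP; rewrite -addr_eq0 addrC bdf.
  by apply: nonfaceN; apply: nonface_bd.
have [y [cy Jy yz]] : exists y, [/\ chain (fun=> 0%N) i j.-1 y,
    forall A, nonface_mod W (y A) & bd y =1 bd z2].
  (* In homological degree 0 the boundary of [z2] is zero, so [y = 0] serves. *)
  case: i ij c2 {cf c1} => [|i] ij c2.
    exists (fun=> 0); split=> [A a mon|A|A]; first by rewrite mxE msupp0.
      exact: nonface0.
    transitivity (0 : 'rV[S]_1).
      by rewrite /bd big1 // => l _; rewrite scaler0.
    rewrite /bd big1 // => l lA; apply/rowP => a; rewrite !mxE; apply/eqP; rewrite mulf_eq0 -[z2 _ _ _ == 0]msupp_eq0.
    case E : (msupp _) => [|mon s]; first by rewrite eqxx orbT.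
    have := c2 (l |: A) a mon; rewrite E inE eqxx => /(_ isT)[].
    by rewrite cardsU1 lA.
  have [||y [cy Jy yz]] := H i j.-1 _ _ (chain_bd c2) J2; first by lia.
    exact: bd_bd.
  by exists y.
have [|||w' [cw' w'E]] := @bd_exact _ _ char0 1 (fun=> 0%N) i j.-1 (fun A => z2 A - y A).
- by apply: chainD c2 _; apply: chainN.
- by move=> A; rewrite bdB yz subrr.
- by move=> *; lia.
have [||||w [cw Jw wE]] := H i j _ (fun A => z1 A + 'X_v *: y A).
- by lia.
- by apply: chainD c1 _; rewrite -(@prednK j); [apply: chainX|lia].
- by move=> A; apply: nonfaceD (J1 A) (nonfaceZ (p := 'X_v) (Jy A)).
- by move=> A; rewrite bdD bdZ yz bdf.
exists (fun A => w A + 'X_v *: w' A); split.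
- by apply: chainD cw _; rewrite -(@prednK j); [apply: chainX|lia].
- move=> A; apply: nonfaceD; last exact: nonface_out.
  by apply: nonfaceS (Jw A); apply: subD1set.
- move=> A; rewrite bdD bdZ wE w'E fE scalerBr.
  by rewrite -addrA [_ + (_ - _)]addrC subrK.
Qed.

End Complex.

(** Start from all vertices, where the ideal is zero, and delete vertices one at a time; in a
    complete graph each is a cone point. *)
Lemma regle_complete W : regle (fun u v => u != v) W 1.
Proof.
have cl (A : {set 'I_n}) : clique (fun u v : 'I_n => u != v) A by apply/cliqueP.
have [m leW] := ubnP #|~: W|; elim: m W leW => // m IH W; rewrite ltnS => leW.
have [W0|[v]] := set_0Vmem (~: W).
  have -> : W = setT by rewrite -[W]setCK W0 setC0.
  move=> i j _ f _ Jf _; have f0 A : f A = 0.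
    apply/rowP => a; apply/mpolyP => mon; rewrite !mxE mcoeff0.
    by apply/eqP; rewrite mcoeff_eq0; apply/negP => /Jf; rewrite /face subsetT cl.
  exists (fun=> 0); split=> [A a mon|A|A]; first by rewrite mxE msupp0.
    exact: nonface0.
  by rewrite f0 /bd big1 // => l _; rewrite scaler0.
rewrite inE => vW; have -> : W = (v |: W) :\ v by rewrite setU1K.
apply: regle_cone.
- by move=> x y; rewrite eq_sym.
- exact: setU11.
- apply/setP => u; rewrite in_set -[X in _ = X]andbT; congr (_ && _).
  by rewrite [v == u]eq_sym orbN.
apply: IH; apply: leq_trans leW; apply: proper_card.
rewrite setCU properE subsetIr /=; apply/subsetPn; exists v; first by rewrite inE.
by rewrite !inE eqxx.
Qed.

Variable e : rel 'I_n.
Hypotheses (e_sym : ssrbool.symmetric e) (e_irr : irreflexive e).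

Lemma regle_clique W : clique e W -> regle e W 1.
Proof.
move=> cW; have fE mon : face e W mon = face (fun u v => u != v) W mon.
  rewrite /face; case: (boolP (_ \subset W)) => //= sW.
  by rewrite (cliqueS sW cW); apply/esym/cliqueP.
move=> i j ij f cf Jf f0.
have [|g [cg Jg gf]] := @regle_complete W i j ij f cf _ f0.
  by move=> A a mon /Jf; rewrite fE.
by exists g; split=> // A a mon /Jg; rewrite fE.
Qed.

Lemma hole_freeS (A B : {set 'I_n}) : A \subset B -> hole_free e B -> hole_free e A.
Proof. by move=> /subsetP sAB fB l h Hh hA; apply: (fB l h Hh) => i /hA/sAB. Qed.

Lemma regle_elim (P : {set 'I_n} -> Prop) r :
  (forall A B : {set 'I_n}, A \subset B -> P B -> P A) -> regle e set0 r.+1 ->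
  (forall W, P W -> W != set0 ->
     exists2 v, v \in W & regle e (closed_nbhd e W v) r) ->
  forall W, P W -> regle e W r.+1.
Proof.
move=> PS H0 HP W; have [m leW] := ubnP #|W|; elim: m W leW => // m IH W.
rewrite ltnS => leW PW; have [->//|W0] := eqVneq W set0.
have [v vW Hv] := HP W PW W0; apply: (regle_vertex e_sym vW Hv).
apply: IH; last by apply: PS PW; apply: subD1set.
by apply: leq_trans leW; rewrite (cardsD1 v W) vW.
Qed.

Lemma regle_empty r : regle e set0 r.+1.
Proof.
elim: r => [|r IH]; last exact: regleS.
by apply: regle_clique; apply/cliqueP => u v; rewrite inE.
Qed.

Lemma regle_chordal W : hole_free e W -> regle e W 2.
Proof.
apply: (@regle_elim (hole_free e)) => [A B||{}W fW W0].
- exact: hole_freeS.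
- exact: regle_empty.
have [v vW cv] := simplicial_vertex e_sym e_irr fW W0.
by exists v => //; apply: regle_clique.
Qed.

Lemma regle_ehf W : even_hole_free e -> regle e W 3.
Proof.
move=> ehf; apply: (@regle_elim (fun=> True)) => // [|{}W _ W0].
  exact: regle_empty.
have [v vW fv] := hole_free_vertex e_sym e_irr ehf W0.
by exists v => //; apply: regle_chordal.
Qed.

End Faces.

(** * Graded modules and their syzygies *)

Section Select.
Local Open Scope ring_scope.
Variables (k : fieldType) (n : nat).
Notation S := {mpoly k[n]}.
Implicit Types (P Q : pred 'X_{1..n}) (p q : S).

Lemma mselectD P p q : mselect P (p + q) = mselect P p + mselect P q.
Proof.
apply/mpolyP => m; rewrite mcoeffD !mcoeff_mselect mcoeffD.
by case: (P m); rewrite ?addr0.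
Qed.

Lemma mselect_id P p : {in msupp p, forall m, P m} -> mselect P p = p.
Proof.
move=> H; apply/mpolyP => m; rewrite mcoeff_mselect.
by case: (boolP (m \in msupp p)) => [/H->//|/memN_msupp_eq0->]; rewrite if_same.
Qed.

Lemma mselect_none P p : {in msupp p, forall m, ~~ P m} -> mselect P p = 0.
Proof.
move=> H; apply/mpolyP => m; rewrite mcoeff_mselect mcoeff0.
by case: (boolP (m \in msupp p)) => [/H/negbTE->//|/memN_msupp_eq0->]; rewrite if_same.
Qed.

Lemma msuppMP p q m : m \in msupp (p * q) ->
  exists m1 m2, [/\ m1 \in msupp p, m2 \in msupp q & m = (m1 + m2)%MM].
Proof. by move=> /msuppM_le/allpairsP[[m1 m2] /= [? ? ->]]; exists m1, m2. Qed.

Lemma mselectM P Q p q :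
  (forall m1 m2, m2 \in msupp q -> P (m1 + m2)%MM = Q m1) ->
  mselect P (p * q) = mselect Q p * q.
Proof.
move=> PQ; rewrite -[p in LHS](mselectC Q) mulrDl mselectD.
have -> : mselect P (mselect Q p * q) = mselect Q p * q.
  apply: mselect_id => m /msuppMP[m1 [m2 [m1p m2q ->]]].
  by move: m1p; rewrite mselect_supp PQ // => /andP[].
have -> : mselect P (mselect (predC Q) p * q) = 0.
  apply: mselect_none => m /msuppMP[m1 [m2 [m1p m2q ->]]].
  by move: m1p; rewrite mselect_supp PQ // => /andP[].
by rewrite addr0.
Qed.

Lemma mselect_sum P (I : Type) (r : seq I) (R : pred I) (F : I -> S) :
  mselect P (\sum_(i <- r | R i) F i) = \sum_(i <- r | R i) mselect P (F i).
Proof.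
apply: (big_morph (mselect P)); first exact: mselectD.
by apply: mselect_none => m; rewrite msupp0.
Qed.
End Select.

Section Graded.
Local Open Scope ring_scope.
Variables (k : fieldType) (n : nat).
Notation S := {mpoly k[n]}.
Hypothesis char0 : [pchar k] =i pred0.

Definition vhomog m (d : 'I_m -> nat) j (v : 'rV[S]_m) : Prop :=
  forall a mon, mon \in msupp (v 0 a) -> (mdeg mon + d a)%N = j.

Definition hsel m (d : 'I_m -> nat) (P : pred nat) (v : 'rV[S]_m) : 'rV[S]_m :=
  \row_a mselect (fun mon => P (mdeg mon + d a)%N) (v 0 a).

Definition graded_mx m' m (d' : 'I_m' -> nat) (d : 'I_m -> nat) (D : 'M[S]_(m', m)) :=
  forall a b mon, mon \in msupp (D a b) -> (mdeg mon + d b)%N = d' a.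

Definition gsub m (d : 'I_m -> nat) (Z : 'rV[S]_m -> Prop) : Prop :=
  [/\ forall u v, Z u -> Z v -> Z (u + v), forall p v, Z v -> Z (p *: v)
    & forall j v, Z v -> Z (hsel d (pred1 j) v)].

Section Basic.
Variables (m m' : nat) (d : 'I_m -> nat) (d' : 'I_m' -> nat).
Implicit Types (v : 'rV[S]_m) (Z : 'rV[S]_m -> Prop).

Lemma vhomog_hsel j v : vhomog d j (hsel d (pred1 j) v).
Proof. by move=> a mon; rewrite mxE mselect_supp => /andP[/eqP]. Qed.

Lemma hsel_id (P : pred nat) v :
  (forall a mon, mon \in msupp (v 0 a) -> P (mdeg mon + d a)%N) -> hsel d P v = v.
Proof. by move=> H; apply/rowP => a; rewrite mxE mselect_id // => mon /H. Qed.

Lemma hsel0 P : hsel d P 0 = 0.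
Proof. by apply/rowP => a; rewrite !mxE mselect_none // => mon; rewrite msupp0. Qed.

Lemma hsel_decomp v : exists N, v = \sum_(j < N) hsel d (pred1 (j : nat)) v.
Proof.
(* This bound exceeds the degree of every term of [v]. *)
exists (\sum_a (msize (v 0%R a) + d a))%N; apply/rowP => a; apply/mpolyP => mon.
rewrite summxE raddf_sum /=.
under eq_bigr => j _ do rewrite mxE mcoeff_mselect /=.
have [vm|/memN_msupp_eq0 E] := boolP (mon \in msupp (v 0 a)); last first.
  by rewrite E big1 // => j _; rewrite if_same.
have lt : (mdeg mon + d a < \sum_a (msize (v 0%R a) + d a))%N.
  rewrite (bigD1 a) //=; apply: ltn_addr; rewrite ltn_add2r.
  exact: msize_mdeg_lt.
rewrite (bigD1 (Ordinal lt)) //= eqxx big1 ?addr0 // => j.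
by rewrite -val_eqE /= eq_sym => /negbTE->.
Qed.

Lemma hsel_mulmx P (D : 'M[S]_(m', m)) (w : 'rV[S]_m') : graded_mx d' d D ->
  hsel d P (w *m D) = hsel d' P w *m D.
Proof.
move=> gD; apply/rowP => b; rewrite !mxE mselect_sum; apply: eq_bigr => a _.
rewrite !mxE; apply: mselectM => m1 m2 /gD E.
by rewrite mdegD -addnA E.
Qed.

Lemma gsub_sum Z (I : Type) (r : seq I) (P : pred I) (F : I -> 'rV[S]_m) :
  gsub d Z -> Z 0 -> (forall i, P i -> Z (F i)) -> Z (\sum_(i <- r | P i) F i).
Proof. by case=> ZD _ _ Z0 H; apply: big_ind. Qed.

Lemma gsub_ker (D : 'M[S]_(m', m)) : graded_mx d' d D -> gsub d' (fun w => w *m D = 0).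
Proof.
move=> gD; split=> [u v u0 v0|p v v0|j v v0].
- by rewrite mulmxDl u0 v0 addr0.
- by rewrite -scalemxAl v0 scaler0.
- by rewrite -hsel_mulmx // v0 hsel0.
Qed.

Lemma msupp_mulmx (D : 'M[S]_(m', m)) (w : 'rV[S]_m') b mon :
  mon \in msupp ((w *m D) 0 b) -> exists a m1 m2,
    [/\ m1 \in msupp (w 0 a), m2 \in msupp (D a b) & mon = (m1 + m2)%MM].
Proof.
rewrite mxE => /msupp_sum_le/flatten_mapP[a _ /msuppMP[m1 [m2 H]]].
by exists a, m1, m2.
Qed.

Section Syzygies.
Variables (D : 'M[S]_(m', m)) (Z : 'rV[S]_m -> Prop).
Hypothesis gD : graded_mx d' d D.
Hypothesis ZD : forall v, Z v <-> exists w, v = w *m D.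
Hypothesis minD : forall w : 'rV[S]_m', w *m D = 0 -> forall a, (w 0 a)@_0%MM = 0.

(* The connecting homomorphism of 0 -> ker D -> F -> Z -> 0 is onto the Koszul
   homology of ker D. *)
Lemma vanish_ker i j : vanish d Z i.+1 j -> vanish d' (fun w => w *m D = 0) i j.
Proof.
move=> vZ f cf Df f0.
have [|w [cw wf]] := bd_exact char0 cf f0 _.
  (* Minimality excludes constant terms in relations, so [d' a < j], as [bd_exact] requires. *)
  move=> A a mon mf; have [_ E] := cf _ _ _ mf.
  have : mdeg mon != 0%N.
    rewrite mdeg_eq0; apply: contraL mf => /eqP->.
    by rewrite mcoeff_msupp minD ?eqxx.
  by clear -E; lia.
have [|||u [cu Zu uE]] := vZ (fun A => w A *m D).
- move=> A b mon /msupp_mulmx[a [m1 [m2 [/cw[cA E] /gD E2 ->]]]].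
  by split=> //; move: E; rewrite mdegD -E2; clear; lia.
- by move=> A; apply/ZD; exists (w A).
- by move=> A; rewrite bd_mulmx wf Df.
have [y yE] : exists y : {set 'I_n} -> 'rV[S]_m', forall A, u A = y A *m D.
  have H A : exists w', u A = w' *m D by apply/ZD/Zu.
  exists (fun A => proj1_sig (constructive_indefinite_description _ (H A))) => A.
  by case: constructive_indefinite_description.
(* Arbitrary preimages are cut down to the right degrees; their images are unchanged, as [D] is
   graded. *)
pose y' (A : {set 'I_n}) := if #|A| == i.+2 then hsel d' (fun t => (t + i.+2)%N == j) (y A) else 0.
have y'E A : u A = y' A *m D.
  rewrite /y'; case: eqP => [_|cA].
    rewrite -hsel_mulmx // -yE hsel_id // => a mon /cu[_ E].
    exact/eqP.
  rewrite mul0mx; apply/rowP => a; rewrite mxE; apply/eqP; rewrite -msupp_eq0.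
  case E : (msupp _) => [//|mon s].
  by have [|/cA] := cu A a mon; rewrite ?E ?inE ?eqxx.
have cy : chain d' i.+2 j y'.
  move=> A a mon; rewrite /y'; case: eqP => cA; rewrite mxE ?msupp0 //.
  by rewrite mselect_supp => /andP[/eqP].
(* Subtracting the boundary of [y'] moves [w] into the kernel without changing its boundary. *)
exists (fun A => w A - bd y' A); split=> [|A|A].
- by apply: chainD cw (chainN (chain_bd cy)).
- rewrite mulmxBl -bd_mulmx -uE; apply/eqP; rewrite subr_eq0; apply/eqP/eq_bd.
  exact: y'E.
- by rewrite bdB bd_bd // subr0.
Qed.

(** Homology in degree 0 is [Z] modulo the variables. If row [a] vanished there, a relation with
    constant term 1 at [a] would contradict minimality. *)
Lemma no_generator j : vanish d Z 0 j -> forall a, d' a <> j.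
Proof.
move=> vZ a da; pose f (A : {set 'I_n}) := if A == set0 then row a D else 0.
have nz l (A : {set 'I_n}) : (l |: A == set0) = false.
  by apply/negbTE/set0Pn; exists l; apply: setU11.
have [|||g [_ Zg gE]] := vZ f.
- move=> A b mon; rewrite /f; case: eqP => [->|_]; rewrite mxE ?msupp0 //.
  by move=> /gD; rewrite da cards0 addn0.
- move=> A; apply/ZD; rewrite /f; case: eqP => _.
    by exists (delta_mx 0 a); rewrite rowE.
  by exists 0; rewrite mul0mx.
- by move=> A; rewrite /bd big1 // => l _; rewrite /f nz scaler0.
have [y yE] : exists y : {set 'I_n} -> 'rV[S]_m', forall A, g A = y A *m D.
  have H A : exists w', g A = w' *m D by apply/ZD/Zg.
  exists (fun A => proj1_sig (constructive_indefinite_description _ (H A))) => A.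
  by case: constructive_indefinite_description.
have : (delta_mx 0 a - bd y set0) *m D = 0.
  rewrite mulmxBl -rowE -bd_mulmx; have := gE set0; rewrite {1}/f eqxx => <-.
  by apply/eqP; rewrite subr_eq0; apply/eqP/eq_bd.
move/minD/(_ a); rewrite !mxE !eqxx mcoeffB mcoeff1 eqxx bd_bd1 /bd1 raddf_sum /=.
rewrite big1 ?subr0 => [/eqP|l _]; first by rewrite oner_eq0.
rewrite /ksign -signr_odd -mulrA; case: odd; rewrite ?expr0 ?mul1r ?expr1 ?mulN1r ?mcoeffN;
  by rewrite mcoeffXM mnm0E eqxx ?oppr0.
Qed.
End Syzygies.
End Basic.
End Graded.

(** * Minimal generators *)

Section Subspaces.
Local Open Scope ring_scope.

(** A largest linearly independent family of vectors of [U] spans [U]. *)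
Lemma subspace_basis (k : fieldType) N (U : 'rV[k]_N -> Prop) :
  exists r (B : 'M[k]_(r, N)), (forall i, U (row i B)) /\ forall c, U c -> (c <= B)%MS.
Proof.
pose P r := exists B : 'M[k]_(r, N), (forall i, U (row i B)) /\ row_free B.
have [r [[s [sr [B [UB fB]]]] rmin]] : exists r, (exists s, (N - s)%N = r /\ P s) /\
    forall r', (exists s, (N - s)%N = r' /\ P s) -> (r <= r')%N.
  apply: ex_least; exists (N - 0)%N, 0%N; split=> //; exists 0; split=> [[]//|].
  by rewrite /row_free mxrank0.
exists s, B; split=> // c Uc; apply: contraT => ncB.
have : P (1 + s)%N.
  exists (col_mx c B); split=> [i|].
    case: (split_ordP i) => j ->; rewrite ?rowKu ?rowKd //.
    by rewrite row_id.
  rewrite /row_free -addsmxE eqn_leq; apply/andP; split.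
    by rewrite addsmxE rank_leq_row.
  rewrite add1n -{1}(eqP fB); apply: rank_ltmx.
  by rewrite ltmxE addsmxSr /= addsmx_sub negb_and ncB.
move=> Ps; have := rmin _ (ex_intro _ (1 + s)%N (conj erefl Ps)).
have [B' [_ /eqP rB']] := Ps; have := rank_leq_col B'; rewrite rB' -sr.
by clear; lia.
Qed.

End Subspaces.

Section Generation.
Local Open Scope ring_scope.
Variables (k : fieldType) (n : nat).
Notation S := {mpoly k[n]}.

(** Elements of degree [j] have coordinates indexed by the finitely many pairs of a position and a
    monomial of degree at most [j], which reduces the claim to linear algebra over [k]. *)
Lemma span_vhomog m (d : 'I_m -> nat) j (Z : 'rV[S]_m -> Prop) :
  exists m' (D : 'M[S]_(m', m)), (forall i, Z (row i D) /\ vhomog d j (row i D)) /\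
    forall v, Z v -> vhomog d j v -> exists w, v = w *m D.
Proof.
pose T : finType := ('I_m * 'X_{1..n < j.+1})%type.
pose phi (c : 'rV[k]_#|T|) : 'rV[S]_m :=
  \row_a \sum_(mon : 'X_{1..n < j.+1}) c 0 (enum_rank (a, mon)) *: 'X_[mon].
have [r [B [UB Bgen]]] := subspace_basis (fun c => Z (phi c) /\ vhomog d j (phi c)).
exists r, (\matrix_i phi (row i B)); split=> [i|v Zv hv].
  by rewrite rowK; apply: UB.
pose c : 'rV[k]_#|T| := \row_t (v 0 (enum_val t : T).1)@_((enum_val t : T).2).
have phic : phi c = v.
  apply/rowP => a; rewrite mxE [RHS](@mpolywE _ _ j.+1).
    by apply: eq_bigr => mon _; rewrite mxE enum_rankK.
  rewrite msizeE; apply/bigmax_leqP_seq => mon /hv <- _; rewrite ltnS; exact: leq_addr.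
have [|y cE] := submxP (Bgen c _); first by rewrite phic.
exists (map_mx (@mpolyC n k) y); rewrite -phic; apply/rowP => a; rewrite !mxE.
under eq_bigr => mon _ do rewrite cE mxE scaler_suml.
rewrite exchange_big /=; apply: eq_bigr => i _; rewrite !mxE mul_mpolyC scaler_sumr.
by apply: eq_bigr => mon _; rewrite mxE scalerA.
Qed.

Definition generates m m' (d' : 'I_m' -> nat) (d : 'I_m -> nat) (D : 'M[S]_(m', m))
    (Z : 'rV[S]_m -> Prop) :=
  graded_mx d' d D /\ forall v, Z v <-> exists w, v = w *m D.

Section FiniteGeneration.
Variables (m : nat) (d : 'I_m -> nat) (Z : 'rV[S]_m -> Prop) (r : nat).
Hypotheses (gZ : gsub d Z) (Z0 : Z 0).
Hypothesis vZ : forall j, (r < j)%N -> vanish d Z 0 j.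

Lemma bounded_generators N : exists m' (d' : 'I_m' -> nat) (D : 'M[S]_(m', m)),
  [/\ graded_mx d' d D, forall i, Z (row i D) &
    forall j v, (j <= N)%N -> Z v -> vhomog d j v -> exists w, v = w *m D].
Proof.
elim: N => [|N [m1 [d1 [D1 [g1 Z1 gen1]]]]].
  have [m' [D [DP gen]]] := span_vhomog d 0 Z.
  exists m', (fun=> 0%N), D; split=> [i b mon|i|j v]; last by rewrite leqn0 => /eqP->; apply: gen.
    by have [_ h] := DP i; have := h b mon; rewrite mxE.
  by case: (DP i).
have [m2 [D2 [DP gen2]]] := span_vhomog d N.+1 Z.
exists (m1 + m2)%N, (fun i => if split i is inl i1 then d1 i1 else N.+1), (col_mx D1 D2).
split=> [i b mon|i|j v].
- case: (split_ordP i) => i' ->; rewrite ?col_mxEu ?col_mxEd.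
    exact: g1.
  by have [_ h] := DP i'; have := h b mon; rewrite mxE.
- by case: (split_ordP i) => i' ->; rewrite ?rowKu ?rowKd //; case: (DP i').
rewrite leq_eqVlt => /predU1P[->|]; last rewrite ltnS => jN.
  move=> Zv hv; have [w ->] := gen2 v Zv hv.
  by exists (row_mx 0 w); rewrite mul_row_col mul0mx add0r.
move=> Zv hv; have [w ->] := gen1 j v jN Zv hv.
by exists (row_mx w 0); rewrite mul_row_col mul0mx addr0.
Qed.

(** Above degree [r], [Z] modulo the variables vanishes, so an element of degree [j] is a
    combination, with variables as coefficients, of elements of [Z] of degree [j - 1]. *)
Lemma finitely_generated : exists m' (d' : 'I_m' -> nat) (D : 'M[S]_(m', m)),
  generates d' d D Z.
Proof.
have [m' [d' [D [gD ZD gen]]]] := bounded_generators r.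
exists m', d', D; split=> // v; split=> [Zv|[w ->]]; last first.
  rewrite mulmx_sum_row; apply: (gsub_sum (d := d)) => // i _.
  by case: gZ => _ ZZ _; apply: ZZ.
have genh j u : Z u -> vhomog d j u -> exists w, u = w *m D.
  elim/ltn_ind: j u => j IH u Zu hu; have [/gen|rj] := leqP j r; first exact.
  pose f (A : {set 'I_n}) := if A == set0 then u else 0.
  have nz l (A : {set 'I_n}) : (l |: A == set0) = false.
    by apply/negbTE/set0Pn; exists l; apply: setU11.
  have [|||g [cg Zg gE]] := vZ rj (f := f).
  - move=> A b mon; rewrite /f; case: eqP => [->|_]; last by rewrite mxE msupp0.
    by move=> /hu; rewrite cards0 addn0.
  - by move=> A; rewrite /f; case: eqP.
  - by move=> A; rewrite /bd big1 // => l _; rewrite /f nz scaler0.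
  have uE : u = bd g set0 by rewrite gE /f eqxx.
  have [j' jE] : exists j', j = j'.+1 by exists j.-1; rewrite prednK //; apply: leq_ltn_trans rj.
  have H A : exists w, g A = w *m D.
    apply: (IH j') => //; first by rewrite jE.
    by move=> a mon /cg[_]; rewrite jE addn1 => -[].
  pose y A := proj1_sig (constructive_indefinite_description _ (H A)).
  exists (bd y set0); rewrite uE -bd_mulmx; apply: eq_bd => A.
  by rewrite /y; case: constructive_indefinite_description.
have [N ->] := hsel_decomp d v.
apply: (big_ind (fun u => exists w, u = w *m D)) => [|u1 u2 [w1 ->] [w2 ->]|j _].
- by exists 0; rewrite mul0mx.
- by exists (w1 + w2); rewrite mulmxDl.
apply: (genh j); last exact: vhomog_hsel.
by case: gZ => _ _; apply.
Qed.

(* In a generating family of minimal length, a relation with an invertible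
   coefficient would make one generator superfluous. *)
Lemma minimal_generators : exists m' (d' : 'I_m' -> nat) (D : 'M[S]_(m', m)),
  generates d' d D Z /\
  forall w : 'rV[S]_m', w *m D = 0 -> forall a, (w 0 a)@_0%MM = 0.
Proof.
have [m' [[d' [D [gD ZD]]] mmin]] := ex_least finitely_generated.
exists m', d', D; split=> // w w0 a; apply/eqP; apply: contraT => c0.
case: m' d' D gD ZD mmin w w0 a c0 => [|m'] d' D gD ZD mmin w w0 a c0; first by case: a c0.
suff /mmin : exists (d'' : 'I_m' -> nat) (D' : 'M[S]_(m', m)), generates d'' d D' Z.
  by rewrite ltnn.
pose c := (w 0 a)@_0%MM.
(* The component of degree [d' a] of the relation has a constant entry at [a], normalized to 1. *)
pose w1 := c^-1%:MP *: hsel d' (pred1 (d' a)) w.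
have w1D : w1 *m D = 0 by rewrite -scalemxAl -(hsel_mulmx _ _ gD) w0 hsel0 scaler0.
have w1a : w1 0 a = 1.
  rewrite !mxE mul_mpolyC; apply/mpolyP => mon; rewrite mcoeffZ mcoeff_mselect mcoeff1 /=.
  rewrite -[X in _ == X]add0n eqn_add2r mdeg_eq0.
  by case: eqP => [->|_]; rewrite ?mulr0 // mulVf.
exists (fun i => d' (lift a i)), (row' a D); split=> [i b mon|v].
  by rewrite mxE => /gD.
rewrite ZD; split=> -[x ->]; last first.
  exists (\row_i (if unlift a i is Some i' then x 0 i' else 0)).
  rewrite !mulmx_sum_row [RHS](bigD1_ord a) //= mxE unlift_none scale0r add0r.
  apply: eq_bigr => i _; rewrite mxE liftK; congr (_ *: _).
  by apply/rowP => b; rewrite !mxE.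
(* Subtracting a multiple of the relation eliminates generator [a]. *)
have -> : x *m D = (x - x 0 a *: w1) *m D.
  by rewrite mulmxBl -scalemxAl w1D scaler0 subr0.
have : (x - x 0 a *: w1) 0 a = 0.
  by rewrite [LHS]mxE [X in _ + X]mxE [X in _ - X]mxE w1a mulr1 subrr.
move: (x - _) => z za; exists (col' a z).
apply/rowP => b; rewrite [LHS]mxE [RHS]mxE (bigD1_ord a) //= za mul0r add0r.
by apply: eq_bigr => i _; rewrite !mxE.
Qed.
End FiniteGeneration.
End Generation.

(** * The minimal resolution *)

Section Resolution.
Local Open Scope ring_scope.
Variables (k : fieldType) (n : nat).
Notation S := {mpoly k[n]}.
Hypothesis char0 : [pchar k] =i pred0.

Definition regular m (d : 'I_m -> nat) (Z : 'rV[S]_m -> Prop) r : Prop :=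
  [/\ gsub d Z, Z 0 & forall i j, (i + r < j)%N -> vanish d Z i j].

(** The rank changes at each step, so modules are packed with their data for iteration. *)
Record stage := Stage {
  st_rank : nat;
  st_deg : 'I_st_rank -> nat;
  st_mod : 'rV[S]_st_rank -> Prop;
  st_reg : nat;
  st_regular : regular st_deg st_mod st_reg
}.

Record cover (s : stage) := Cover {
  cov_rank : nat;
  cov_deg : 'I_cov_rank -> nat;
  cov_mx : 'M[S]_(cov_rank, st_rank s);
  cov_gen : generates cov_deg (@st_deg s) cov_mx (@st_mod s);
  cov_min : forall w : 'rV[S]_cov_rank, w *m cov_mx = 0 -> forall a, (w 0 a)@_0%MM = 0
}.

Lemma cover_exists s : exists c : cover s, True.
Proof.
have [gZ Z0 vZ] := st_regular s.
have [|m' [d' [D [gen min]]]] := @minimal_generators _ _ _ _ _ (st_reg s) gZ Z0.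
  by move=> j; apply: (vZ 0%N).
by exists (Cover gen min).
Qed.

Definition min_cover s : cover s :=
  proj1_sig (constructive_indefinite_description _ (cover_exists s)).

(** Passing to syzygies lowers the homological degree by one at fixed internal degree, so the bound
    rises by one. *)
Lemma syzygy_regular s (c : cover s) :
  regular (@cov_deg s c) (fun w => w *m cov_mx c = 0) (st_reg s).+1.
Proof.
have [gZ Z0 vZ] := st_regular s; have [gD ZD] := cov_gen c; split.
- exact: gsub_ker gD.
- by rewrite mul0mx.
move=> i j ij; apply: (vanish_ker char0 gD ZD (@cov_min s c)).
by apply: vZ; rewrite addSnnS.
Qed.

Definition next_stage s : stage := Stage (syzygy_regular (min_cover s)).

Section Ideal.
Variables (I : S -> Prop) (r : nat).
Hypothesis regI : regular (fun _ : 'I_1 => 0%N) (fun v => I (v 0 0)) r.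

Definition stages i : stage := iter i next_stage (Stage regI).

(** Stage [0] is the ideal; the free module of index [i] covers stage [i] and is the ambient module
    of stage [i + 1]. *)
Definition syzygy_resolution : free_seq k n :=
  @FreeSeq k n (fun i => st_rank (stages i.+1)) (fun i => @st_deg (stages i.+1))
    (fun i => cov_mx (min_cover (stages i.+1))) (cov_mx (min_cover (stages 0))).

Lemma syzygy_resolutionP : minimal_graded_free_resolution I syzygy_resolution.
Proof.
split.
- split=> [a|i a b mon].
    apply/dhomogP => mon; have [gD _] := cov_gen (min_cover (stages 0)).
    by move=> /gD; rewrite addn0.
  by have [gD _] := cov_gen (min_cover (stages i.+1)); apply: gD.
- split=> [p|v|i v].
  + have [_ ZD] := cov_gen (min_cover (stages 0)).
    have -> : I p <-> @st_mod (stages 0) (\row_(_ < 1) p) by rewrite /= mxE.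
    rewrite ZD; split=> -[v E]; exists v; first by rewrite -E mxE.
    by apply/rowP => a; rewrite mxE E (ord1 a).
  + exact: (cov_gen (min_cover (stages 1))).2.
  + exact: (cov_gen (min_cover (stages i.+2))).2.
move=> i a b; have := @cov_min _ (min_cover (stages i)) (row a (fr_diff syzygy_resolution i)).
rewrite -(_ : row a (fr_diff syzygy_resolution i) 0 b = fr_diff syzygy_resolution i a b); last by rewrite mxE.
apply; have := (cov_gen (min_cover (stages i.+1))).2 (row a (fr_diff syzygy_resolution i)).
by case=> _; apply; exists (delta_mx 0 a); rewrite rowE.
Qed.

Lemma eq_vanish m (d : 'I_m -> nat) (Z Z' : 'rV[S]_m -> Prop) i j :
  (forall v, Z v <-> Z' v) -> vanish d Z i j -> vanish d Z' i j.
Proof.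
move=> ZZ' H f cf Zf f0; have [|g [cg Zg gf]] := H f cf _ f0; first by move=> A; apply/ZZ'.
by exists g; split=> // A; apply/ZZ'.
Qed.

(** Stated for every minimal resolution, hence for the one picked by [the_resolution]: [vanish_ker]
    carries the bound along the syzygies and [no_generator] turns it into a bound on degrees. *)
Lemma resolution_degree F : minimal_graded_free_resolution I F ->
  forall i (a : 'I_(fr_rank F i)), (fr_deg a <= i + r)%N.
Proof.
case=> -[gaug gdiff] [exI ex0 exS] minF.
have [_ _ vI] := regI.
have min_im i (w : 'rV[S]_(fr_rank F i)) : (exists x, w = x *m fr_diff F i) ->
    forall a, (w 0 a)@_0%MM = 0.
  case=> x -> a; rewrite mxE raddf_sum big1 //= => b _.
  by rewrite rmorphM /= minF mulr0.
have gA : graded_mx (@fr_deg _ _ F 0) (fun _ : 'I_1 => 0%N) (fr_aug F).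
  by move=> a b mon; rewrite (ord1 b) addn0; apply/dhomogP/gaug.
have gD i : graded_mx (@fr_deg _ _ F i.+1) (@fr_deg _ _ F i) (fr_diff F i).
  by move=> a b mon; apply: gdiff.
have ZA (v : 'rV[S]_1) : I (v 0 0) <-> exists w, v = w *m fr_aug F.
  rewrite exI; split=> -[w E]; exists w; last by rewrite E.
  by apply/rowP => a; rewrite (ord1 a).
have mA (w : 'rV[S]_(fr_rank F 0)) : w *m fr_aug F = 0 -> forall a, (w 0 a)@_0%MM = 0.
  by move/ex0; apply: min_im.
have mD i (w : 'rV[S]_(fr_rank F i.+1)) : w *m fr_diff F i = 0 -> forall a, (w 0 a)@_0%MM = 0.
  by move/exS; apply: min_im.
have K i t j : (t + (i.+1 + r) < j)%N ->
    vanish (@fr_deg _ _ F i) (fun v => exists w, v = w *m fr_diff F i) t j.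
  elim: i t j => [|i IH] t j lt.
    apply: (eq_vanish ex0); apply: (vanish_ker char0 gA ZA mA).
    by apply: vI; rewrite addSnnS.
  apply: (eq_vanish (exS i)).
  apply: (vanish_ker char0 (gD i) (fun v => iff_refl _) (@mD i)).
  by apply: IH; rewrite addSnnS -addSn.
move=> i a; rewrite leqNgt; apply/negP => lt.
case: i a lt => [|i] a lt.
  exact: (no_generator gA ZA mA (vI 0%N _ lt) erefl).
exact: (no_generator (gD i) (fun v => iff_refl _) (@mD i) (K i 0%N _ lt) erefl).
Qed.

Lemma the_resolutionP : minimal_graded_free_resolution I (the_resolution I).
Proof.
apply: epsilon_spec; exists syzygy_resolution; exact: syzygy_resolutionP.
Qed.

End Ideal.
End Resolution.

(** * The non-edge ideal and its regularity *)

Section NonedgeIdeal.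
Local Open Scope ring_scope.
Variables (k : fieldType) (n : nat) (e : rel 'I_n).
Notation S := {mpoly k[n]}.

(** A monomial with non-clique support is divisible by $x_i x_j$ for some non-edge, so the ideal is
    $J_W$ for [W = setT]. *)
Lemma nonedge_idealP (p : S) : nonedge_ideal e p <->
  forall mon, mon \in msupp p -> ~~ face e setT mon.
Proof.
split=> [[c ->] mon|].
  move=> /msupp_sum_le/flatten_mapP[i _ /msupp_sum_le/flatten_mapP[j]].
  rewrite mem_filter => /andP[/andP[ij nij] _].
  move=> /msuppMP[m1 [m2 [_ m2ij ->]]]; move: m2ij.
  rewrite -mpolyXD msuppX inE => /eqP->; rewrite /face subsetT /=.
  apply/negP => /cliqueP/(_ i j); rewrite (negbTE nij) !msupportD !msupportU => H.
  by suff : false by []; apply: H; rewrite // !inE eqxx ?orbT.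
have [N0 ND] : nonedge_ideal e (0 : S) /\
    forall q1 q2 : S, nonedge_ideal e q1 -> nonedge_ideal e q2 -> nonedge_ideal e (q1 + q2).
  split=> [|q1 q2 [c1 ->] [c2 ->]].
    exists (fun _ _ => 0); rewrite big1 // => i _; rewrite big1 // => j _.
    by rewrite mul0r.
  exists (fun i j => c1 i j + c2 i j); rewrite -big_split; apply: eq_bigr => i _.
  by rewrite -big_split; apply: eq_bigr => j _; rewrite mulrDl.
move=> H; rewrite [p]mpolyE big_seq; apply: (big_ind (@nonedge_ideal k n e)) => // mon mp.
have := H _ mp; rewrite /face subsetT /= negb_forall_in => /exists_inP[i im].
rewrite negb_forall_in => /exists_inP[j jm]; rewrite negb_imply => /andP[ij nij].
exists (fun i' j' => if (i' == i) && (j' == j) then p@_mon *: 'X_[mon - (U_(i) + U_(j))] else 0).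
rewrite (bigD1 i) //= (bigD1 j) ?ij //= !eqxx /= big1 ?big1 => [|i' /negbTE ne|j' /andP[_ /negbTE ne]].
- rewrite !addr0 -mpolyXD -scalerAl -mpolyXD submK //.
  apply/mnm_lepP => l; rewrite mnmDE !mnm1E.
  move: im jm; rewrite !inE -!lt0n => im jm.
  have [<-|_] := eqVneq i l; first by rewrite [j == i]eq_sym (negbTE ij).
  by have [<-|_] := eqVneq j l.
- by rewrite big1 // => j' _; rewrite ne mul0r.
- by rewrite ne mul0r.
Qed.

End NonedgeIdeal.

Section Regularity.
Local Open Scope ring_scope.

Lemma reg_even_hole_free (k : fieldType) (n : nat) (e : rel 'I_n) :
  [pchar k] =i pred0 -> ssrbool.symmetric e -> irreflexive e ->
  even_hole_free e -> (reg k e <= 3)%N.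
Proof.
move=> char0 e_sym e_irr e_ehf; rewrite /reg; case: excluded_middle_informative => // ncomplete.
pose I := @nonedge_ideal k n e.
have JE (v : 'rV_1) : nonface_mod e setT v <-> I (v 0 0).
  rewrite /I nonedge_idealP; split=> [Jv mon|Iv a mon]; first exact: Jv.
  by rewrite (ord1 a); apply: Iv.
have regI : regular (fun _ : 'I_1 => 0%N) (fun v => I (v 0 0)) 3.
  split=> [||i j ij]; last by apply: (eq_vanish JE); apply: regle_ehf.
    split=> [u v /JE Ju /JE Jv|p v /JE Jv|j v /JE Jv]; apply/JE.
    - exact: nonfaceD.
    - exact: nonfaceZ.
    - by move=> a mon; rewrite mxE mselect_supp => /andP[_ /Jv].
  by apply/JE; apply: nonface0.
have resP := the_resolutionP char0 regI.
have bound s : (exists i, graded_betti I i (i + s) <> 0%N) -> (s <= 3)%N.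
  case=> i /eqP; rewrite cards_eq0 => /set0Pn[a]; rewrite inE => /eqP da.
  by have := resolution_degree char0 regI resP a; rewrite da leq_add2l.
pose P s := exists i, graded_betti I i (i + s) <> 0%N.
apply: (bound); apply: (proj1 (_ : is_max P (epsilon (inhabits 0%N) (is_max P)))).
apply: epsilon_spec.
(* A non-edge makes the ideal nonzero, so the first free module has a generator. *)
have [s0 Ps0] : exists s, P s.
  have [i [j [ij nij]]] : exists i j : 'I_n, i != j /\ ~~ e i j.
    apply: NNPP => no; apply: ncomplete => i j ij; apply: contraT => nij.
    by case: no; exists i, j.
  have [_ [exI _ _] _] := resP.
  have /exI[v pE] : I ('X_i * 'X_j).
    apply/nonedge_idealP => mon; rewrite -mpolyXD msuppX inE => /eqP->.
    apply/negP => /andP[_ /cliqueP/(_ i j)]; rewrite (negbTE nij) !msupportD !msupportU => H.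
    by suff : false by []; apply: H; rewrite // !inE eqxx ?orbT.
  have [a _|no] := pickP (predT : pred 'I_(fr_rank (the_resolution I) 0)).
    exists (fr_deg a), 0%N; apply/eqP; rewrite cards_eq0; apply/set0Pn.
    by exists a; rewrite inE.
  move: pE; rewrite mxE big_pred0 // => /(congr1 (mcoeff (U_(i) + U_(j)))).
  by rewrite -mpolyXD mcoeffX eqxx mcoeff0 => /eqP; rewrite oner_eq0.
(* All values are at most 3, so minimizing [3 - s] yields the maximum that [epsilon] needs. *)
have [m [[s [sm Ps]] smax]] := @ex_least (fun m => exists s, (3 - s)%N = m /\ P s)
  (ex_intro _ _ (ex_intro _ s0 (conj erefl Ps0))).
exists s; split=> // s' Ps'; have := smax _ (ex_intro _ s' (conj erefl Ps')).
by have := bound _ Ps; have := bound _ Ps'; rewrite -sm; clear; lia.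
Qed.

End Regularity.

Theorem corollary1p6 (k : fieldType) (char0 : [pchar k]%R =i pred0)
    (n : nat) (e : rel 'I_n) (e_sym : ssrbool.symmetric e) (e_irr : irreflexive e)
    (e_ehf : even_hole_free e) :
  reg k e <= 3.
Proof. exact: reg_even_hole_free. Qed.
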